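(* Let $X$ be a Cantor space and let $K \subseteq \mathrm{Prob}(X)$ be a set of Borel probability measures on $X$. Then there exists a minimal homeomorphism $g$ of $X$ such that $K$ is exactly the set of all $g$-invariant Borel probability measures on $X$ if, and only if, $K$ is a dynamical simplex.
   Context: A Cantor space is a topological space homeomorphic to the Cantor set. $\mathrm{Prob}(X)$ is the compact space of all Borel probability measures on $X$, with the weak-$*$ topology coming from the dual of $C(X)$. A homeomorphism $g$ of $X$ is minimal if all its orbits $\{g^n(x) : n \in \mathbb{Z}\}$ are dense in $X$. A measure $\mu$ is $g$-invariant if $g_*\mu=\mu$, where $g_*\mu(A)=\mu(g^{-1}(A))$. A nonempty set $K \subseteq \mathrm{Prob}(X)$ is a dynamical simplex if: (1) $K$ is compact and convex; (2) every element of $K$ is atomless and has full support (every nonempty open set has positive measure); (3) $K$ is good: for any two clopen sets $A,B \subseteq X$ such that $\mu(A)<\mu(B)$ for all $\mu\in K$, there exists a clopen subset $C \subseteq B$ such that $\mu(C)=\mu(A)$ for all $\mu \in K$; (4) $K$ is approximately divisible: for any clopen set $A\subseteq X$, any integer $n \geq 1$ and any $\varepsilon>0$, there exists a clopen $B \subseteq A$ such that $n\mu(B) \in [\mu(A)-\varepsilon,\mu(A)]$ for all $\mu \in K$. *)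

(* Defs.v *)
From HB Require Import structures.
From mathcomp Require Import all_boot all_order all_algebra.
From mathcomp Require Import all_classical all_reals all_analysis.

Set Implicit Arguments.
Unset Strict Implicit.
Unset Printing Implicit Defensive.

Import Order.TTheory GRing.Theory Num.Theory.
Import numFieldNormedType.Exports.

Local Open Scope classical_set_scope.
Local Open Scope ring_scope.

Record homeo (X Y : topologicalType) := Homeo {
  homeo_fun :> X -> Y;
  homeo_inv : Y -> X;
  homeo_funK : cancel homeo_fun homeo_inv;
  homeo_invK : cancel homeo_inv homeo_fun;
  homeo_continuous : continuous homeo_fun;
  homeo_inv_continuous : continuous homeo_inv
}.

Definition is_cantor_space (X : topologicalType) : Prop :=
  inhabited (homeo X cantor_space).

Definition homeo_iter (X : topologicalType) (g : homeo X X) (n : int) : X -> X :=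
  match n with
  | Posz k => iter k g
  | Negz k => iter k.+1 (homeo_inv g)
  end.

Definition homeo_orbit (X : topologicalType) (g : homeo X X) (x : X) : set X :=
  range (fun n : int => homeo_iter g n x).

Definition minimal_homeo (X : topologicalType) (g : homeo X X) : Prop :=
  forall x : X, dense (homeo_orbit g x).

(* The base point of [X] is only there because [g_sigma_algebraType] asks for a
   pointed type; it plays no role in the measurable sets. *)
Definition borel (X : ptopologicalType) := g_sigma_algebraType (@open X).

(* A [probability] of the library is a function on all sets, with no constraint
   outside the sigma-algebra.  Normalizing it to 0 there makes Leibniz equality
   on [Prob X R] coincide with equality of Borel measures (see [Prob_ext]); no
   measure is lost (see [Prob_of_probability]). *)
Record Prob (X : ptopologicalType) (R : realType) := MkProb {
  Prob_measure :> probability (borel X) R;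
  Prob_nonmeasurable :
    forall A : set (borel X), ~ measurable A -> Prob_measure A = 0%E
}.

Lemma Prob_ext (X : ptopologicalType) (R : realType) (mu nu : Prob X R) :
  (forall A : set (borel X), measurable A -> mu A = nu A) -> mu = nu.
Proof.
case: mu nu => [mu mu0] [nu nu0] /= munu.
have {munu}E : mu = nu :> (set (borel X) -> \bar R).
  apply/funext => A; have [/munu//|mA] := pselect (measurable A).
  by rewrite mu0// nu0.
case: mu mu0 E => m [[a1 a2] [b] [c] [d] [e] [f] [g]] mu0.
case: nu nu0 => n [[a1' a2'] [b'] [c'] [d'] [e'] [f'] [g']] nu0 /= E.
subst n.
have ? := Prop_irrelevance a1 a1'; subst a1'.
have ? := Prop_irrelevance a2 a2'; subst a2'.
have ? := Prop_irrelevance b b'; subst b'.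
have ? := Prop_irrelevance c c'; subst c'.
have ? := Prop_irrelevance d d'; subst d'.
have ? := Prop_irrelevance e e'; subst e'.
have ? := Prop_irrelevance f f'; subst f'.
have ? := Prop_irrelevance g g'; subst g'.
have ? := Prop_irrelevance mu0 nu0; subst nu0; reflexivity.
Qed.

Section Prob_of_probability.
Context (X : ptopologicalType) (R : realType) (P : probability (borel X) R).

Definition Prob_trunc (A : set (borel X)) : \bar R :=
  if `[< measurable A >] then P A else 0%E.

Let truncE (A : set (borel X)) : measurable A -> Prob_trunc A = P A.
Proof. by move=> mA; rewrite /Prob_trunc asboolT. Qed.

Let trunc0 : Prob_trunc set0 = 0%E.
Proof. by rewrite truncE// measure0. Qed.

Let trunc_ge0 A : (0 <= Prob_trunc A)%E.
Proof. by rewrite /Prob_trunc; case: ifP. Qed.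

Let trunc_sigma_additive : semi_sigma_additive Prob_trunc.
Proof.
move=> F mF tF mUF; rewrite truncE//.
rewrite (_ : (fun n => _) = fun n => (\sum_(0 <= i < n) P (F i))%E).
  exact: measure_semi_sigma_additive.
by apply/funext => n; apply: eq_bigr => i _; rewrite truncE.
Qed.

HB.instance Definition _ :=
  isMeasure.Build _ _ _ Prob_trunc trunc0 trunc_ge0 trunc_sigma_additive.

Let truncT : Prob_trunc setT = 1%E.
Proof. by rewrite truncE// probability_setT. Qed.

HB.instance Definition _ :=
  @Measure_isProbability.Build _ _ _ Prob_trunc truncT.

Lemma Prob_of_probability :
  exists mu : Prob X R, forall A : set (borel X), measurable A -> mu A = P A.
Proof.
have H (A : set (borel X)) : ~ measurable A -> Prob_trunc A = 0%E.
  by move=> mA; rewrite /Prob_trunc asboolF.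
by exists (@MkProb X R Prob_trunc H) => A mA /=; exact: truncE.
Qed.

End Prob_of_probability.

HB.instance Definition _ (X : ptopologicalType) (R : realType) :=
  gen_eqMixin (Prob X R).
HB.instance Definition _ (X : ptopologicalType) (R : realType) :=
  gen_choiceMixin (Prob X R).

(* The weak-* topology is the topology of pointwise convergence on C(X). *)
Definition Prob_functional (X : ptopologicalType) (R : realType)
    (mu : Prob X R) : prod_topology (fun _ : continuousType X R => R) :=
  fun f => \int[mu]_x f x.

HB.instance Definition _ (X : ptopologicalType) (R : realType) :=
  Topological.copy (Prob X R) (initial_topology (@Prob_functional X R)).

Section DynamicalSimplex.
Context (X : ptopologicalType) (R : realType).
Implicit Types (mu nu rho : Prob X R) (K : set (Prob X R)).

Definition invariant_measure (g : X -> X) mu : Prop :=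
  forall A : set (borel X), measurable A ->
    pushforward mu (g : borel X -> borel X) A = mu A.

(* By [Prob_ext], [rho] is the unique element of [Prob X R] with these values. *)
Definition convex_measures K : Prop :=
  forall mu nu (t : R), K mu -> K nu -> 0 <= t <= 1 ->
    exists2 rho, K rho &
      forall A : set (borel X), measurable A ->
        rho A = (t%:E * mu A + (1 - t)%:E * nu A)%E.

Definition measure_atom mu (A : set (borel X)) : Prop :=
  [/\ measurable A, (0 < mu A)%E &
      forall B : set (borel X), measurable B -> B `<=` A ->
        (mu B < mu A)%E -> mu B = 0%E].

Definition atomless mu : Prop := forall A : set (borel X), ~ measure_atom mu A.

Definition full_support mu : Prop :=
  forall U : set X, open U -> U !=set0 -> (0 < mu U)%E.

Definition good_measures K : Prop :=
  forall A B : set X, clopen A -> clopen B ->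
    (forall mu, K mu -> (mu A < mu B)%E) ->
    exists C : set X,
      [/\ clopen C, C `<=` B & forall mu, K mu -> mu C = mu A].

Definition approx_divisible K : Prop :=
  forall (A : set X) (n : nat) (e : R), clopen A -> (1 <= n)%N -> 0 < e ->
    exists B : set X,
      [/\ clopen B, B `<=` A &
          forall mu, K mu -> (mu A - e%:E <= n%:R%:E * mu B <= mu A)%E].

Record dynamical_simplex K : Prop := {
  dsimplex_nonempty : K !=set0;
  dsimplex_compact : compact K;
  dsimplex_convex : convex_measures K;
  dsimplex_atomless : forall mu, K mu -> atomless mu;
  dsimplex_full_support : forall mu, K mu -> full_support mu;
  dsimplex_good : good_measures K;
  dsimplex_approx_divisible : approx_divisible K
}.

End DynamicalSimplex.

(* Main.v *)
Require Import Defs.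
From HB Require Import structures.
From mathcomp Require Import all_boot all_order all_algebra.
From mathcomp Require Import all_classical all_reals all_analysis.
From mathcomp Require Import lra zify ring.

(**
Given a dynamical simplex [K], call two clopen sets equivalent when all measures
in [K] agree on them.  By goodness and a back-and-forth argument, equivalent
clopen sets are exchanged by a homeomorphism preserving [K].  One builds finer
and finer Kakutani-Rokhlin partitions whose columns consist of equivalent
levels, encoded by homeomorphisms with finite orbits and a clopen base.  Cutting
and stacking columns, one can shrink the base and the top to points, and, for
equivalent [A] and [B], make every column contain as many levels in [A] as in
[B].  In the limit [1_A - 1_B] is a coboundary of a homeomorphism [g] for all
equivalent [A] and [B], so that every [g]-invariant measure agrees on equivalent
sets; by goodness, approximate divisibility and separation of convex sets it
then belongs to [K].  The coboundaries also force every orbit to meet every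
clopen set.

Conversely, for a minimal [g], limits of orbit averages along an ultrafilter
give invariant measures.  Goodness is a matching of parentheses along orbits:
if [mu A < mu B] for all invariant [mu], no orbit can have unmatched points of
[A].  Approximate divisibility is obtained by counting modulo [n] the visits to
[A] until the orbit enters a small set.
*)

Set Implicit Arguments.
Unset Strict Implicit.
Unset Printing Implicit Defensive.

Import Order.TTheory GRing.Theory Num.Theory.
Import numFieldNormedType.Exports.

Local Open Scope classical_set_scope.
Local Open Scope ring_scope.

(** Clopen sets are encoded as locally constant boolean functions, and measures as positive
    functionals on locally constant integer functions, so that cutting, stacking and cohomology are
    exact integer computations. The simplex enters as an abstract family of such functionals.

    The obstacle is that the limit must not acquire further invariant measures. Goodness yields sets
    of exactly equal measure, so the difference of two equivalent indicators can be given sum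
    exactly zero over each column; this survives all later stages, since these change the
    homeomorphism at the tops of columns only. An invariant measure of the limit is thus known
    through equalities between equivalent clopen sets, and inequalities must be drawn from them:
    goodness turns a strict inequality over the simplex into an inclusion up to equivalence, and
    approximate divisibility reduces a separating function to a comparison of two clopen sets.

    Base and top must both shrink to points: the bases control continuity of the limit, the tops
    that of its inverse. *)

Definition lc (X : topologicalType) (T : Type) (f : X -> T) : Prop :=
  forall x, \forall y \near x, f y = f x.

(** * Locally constant functions on compact spaces *)

Section LocallyConstant.
Context (X : topologicalType).

Lemma lc_cst T (t : T) : lc (fun _ : X => t).
Proof. by move=> x; near=> y. Unshelve. all: by end_near. Qed.

Lemma lc_comp T U (h : T -> U) (f : X -> T) : lc f -> lc (fun x => h (f x)).
Proof. by move=> lf x; apply: filterS (lf x) => y ->. Qed.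

Lemma lc_comp2 T U V (h : T -> U -> V) (f : X -> T) (g : X -> U) :
  lc f -> lc g -> lc (fun x => h (f x) (g x)).
Proof.
move=> lf lg x.
by apply: filterS2 (lf x) (lg x) => y -> ->.
Qed.

Lemma lc_comp3 T U V W (h : T -> U -> V -> W)
    (f : X -> T) (g : X -> U) (k : X -> V) :
  lc f -> lc g -> lc k -> lc (fun x => h (f x) (g x) (k x)).
Proof.
move=> lf lg lk x.
by apply: filterS3 (lf x) (lg x) (lk x) => y -> -> ->.
Qed.

(** Near a point the selector [e] is constant, so gluing along its fibres needs no finiteness of the
    index type. *)
Lemma lc_diag T U (F : T -> X -> U) (e : X -> T) :
  lc e -> (forall t, lc (F t)) -> lc (fun x => F (e x) x).
Proof.
by move=> le lF x; apply: filterS2 (le x) (lF (e x) x) => y -> ->.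
Qed.

Lemma lc_precomp (Y : topologicalType) T (f : X -> T) (g : Y -> X) :
  continuous g -> lc f -> lc (fun y => f (g y)).
Proof. by move=> cg lf y; exact: (cg y _ (lf (g y))). Qed.

Lemma continuous_if (Y : topologicalType) (c : X -> bool) (u v : X -> Y) :
  lc c -> continuous u -> continuous v ->
  continuous (fun x => if c x then u x else v x).
Proof.
move=> lcc cu cv x A /=.
case: ifP => cx Ax.
  have := cu x A Ax; apply: filterS2 (lcc x) => y /= -> /=.
  by rewrite cx.
have := cv x A Ax; apply: filterS2 (lcc x) => y /= -> /=.
by rewrite cx.
Qed.

Lemma lc_clopen (a : X -> bool) : lc a <-> clopen [set x | a x].
Proof.
split=> [la|[oa ca] x].
  split; first by rewrite openE => x /= ax; apply: filterS (la x) => y /= ->.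
  rewrite -openC openE => x /= /negP/negbTE ax.
  by apply: filterS (la x) => y /= ->; rewrite ax.
have [ax|ax] := boolP (a x).
  by apply: filterS (open_nbhs_nbhs (conj oa ax)) => y /= ->.
have oc : open (~` [set x | a x]) by rewrite openC.
have := open_nbhs_nbhs (conj oc (negP ax : (~` [set x | a x]) x)).
by apply: filterS => y /= /negP/negbTE.
Qed.

Lemma clopen_lc (A : set X) : clopen A -> lc (fun x => x \in A).
Proof.
move=> cA; apply/lc_clopen; congr clopen: cA.
by apply/seteqP; split=> x /=; rewrite in_setE.
Qed.

Hypothesis cX : compact [set: X].

(** A point outside [O] has already left some [F m], hence so has a neighbourhood of it; by
    compactness one index serves all points. *)
Lemma nested_open (F : nat -> set X) (O : set X) :
  (forall n, closed (F n)) -> (forall n m, (n <= m)%N -> F m `<=` F n) ->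
  open O -> (forall x, (forall n, F n x) -> O x) -> exists n, F n `<=` O.
Proof.
move=> cF dF oO FO.
have /compact_near_coveringP cov := cX.
have := @cov nat \oo (fun n x => F n x -> O x) _ _.
case.
  move=> x _; have [Ox|nOx] := pselect (O x).
    near_simpl; exists (O, setT) => /=; last by case=> y n [].
    by split; [exact: open_nbhs_nbhs|exact: filterT].
  have /existsNP[m nFm] : ~ forall n, F n x by move=> /FO.
  near_simpl; exists (~` F m, [set n | (m <= n)%N]) => /=.
    split; last by exists m.
    by apply: open_nbhs_nbhs; split=> //; rewrite openC.
  by case=> y n [/= nFy mn] /(dF _ _ mn).
by move=> n _ /(_ n (leqnn n)) H; exists n => x /H; apply.
Qed.

Lemma nested_nonempty (F : nat -> set X) :
  (forall n, closed (F n)) -> (forall n m, (n <= m)%N -> F m `<=` F n) ->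
  (forall n, F n !=set0) -> exists x, forall n, F n x.
Proof.
move=> cF dF nF; apply: contrapT => /forallNP h.
have [n Fn] := nested_open cF dF open0 (fun x Fx => h x Fx).
by have [x /Fn] := nF n.
Qed.

(** [pickle] ranks the values, and compactness bounds the ranks. The list [ws] holds every value of
    small rank, attained or not. *)
Lemma fin_range (T : countType) (e : X -> T) :
  lc e -> exists ws : seq T, forall x, e x \in ws.
Proof.
move=> le.
have /compact_near_coveringP cov := cX.
have := @cov nat \oo (fun n x => (pickle (e x) < n)%N) _ _; case.
  move=> x _; near_simpl.
  exists ([set y | e y = e x], [set n | (pickle (e x) < n)%N]) => /=.
    by split; [exact: le|exists (pickle (e x)).+1].
  by case=> y n [/= ->].
move=> n _ /(_ n (leqnn n)) H; exists (pmap unpickle (iota 0 n)) => x.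
by rewrite mem_pmap; apply/mapP; exists (pickle (e x));
  rewrite ?pickleK// mem_iota /= H.
Qed.

Lemma lc_bounded (f : X -> int) : lc f ->
  exists M : nat, forall x, (`|f x| <= M)%N.
Proof.
move=> lf; have [ws H] := fin_range lf.
exists (\max_(w <- ws) `|w|)%N => x.
by rewrite (big_rem _ (H x)) /= leq_maxl.
Qed.

End LocallyConstant.

Arguments lc_comp {X T U} h {f}.
Arguments lc_comp2 {X T U V} h {f g}.
Arguments lc_comp3 {X T U V W} h {f g k}.

(** * Positive functionals on integer-valued functions *)

Definition ind (X : Type) (a : X -> bool) (x : X) : int := (a x)%:Z.

(** The trace of a probability measure on locally constant functions. Scalars are integers, to match
    column sums. *)
Record pos_functional (R : realType) (X : topologicalType)
    (l : (X -> int) -> R) : Prop := {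
  pfD : forall f g, lc f -> lc g -> l (fun x => f x + g x) = l f + l g;
  pfZ : forall (k : int) f, lc f -> l (fun x => k * f x) = k%:~R * l f;
  pf_ge0 : forall f, lc f -> (forall x, 0 <= f x) -> 0 <= l f;
  pf1 : l (fun=> 1) = 1
}.

Section PosFunctional.
Context (R : realType) (X : topologicalType).
Hypothesis cX : compact [set: X].

Lemma lc_ind (a : X -> bool) : lc a -> lc (ind a).
Proof. exact: (lc_comp (fun b : bool => b%:Z)). Qed.

Lemma lc_intD (f g : X -> int) : lc f -> lc g -> lc (fun x => f x + g x).
Proof. exact: (lc_comp2 (fun u v : int => u + v)). Qed.

Lemma lc_intB (f g : X -> int) : lc f -> lc g -> lc (fun x => f x - g x).
Proof. exact: (lc_comp2 (fun u v : int => u - v)). Qed.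

Lemma lc_intZ (k : int) (f : X -> int) : lc f -> lc (fun x => k * f x).
Proof. exact: (lc_comp (fun u : int => k * u)). Qed.

Lemma lc_andb (a b : X -> bool) : lc a -> lc b -> lc (fun x => a x && b x).
Proof. exact: (lc_comp2 andb). Qed.

Lemma lc_diff (a b : X -> bool) : lc a -> lc b -> lc (fun x => a x && ~~ b x).
Proof. exact: (lc_comp2 (fun u v : bool => u && ~~ v)). Qed.

Lemma lc_orb (a b : X -> bool) : lc a -> lc b -> lc (fun x => a x || b x).
Proof. exact: (lc_comp2 orb). Qed.

Lemma lc_negb (a : X -> bool) : lc a -> lc (fun x => ~~ a x).
Proof. exact: (lc_comp negb). Qed.

Context (l : (X -> int) -> R).
Hypothesis pl : pos_functional l.
Implicit Types (a b : X -> bool) (f g : X -> int).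

Lemma pf0 : l (fun=> 0) = 0.
Proof.
have := pfZ pl 0 (@lc_cst X _ (0 : int)).
by rewrite [RHS]mul0r mul0r.
Qed.

Lemma pfB f g : lc f -> lc g -> l (fun x => f x - g x) = l f - l g.
Proof.
move=> lf lg; have := pfD pl lf (lc_intZ (-1) lg).
rewrite (pfZ pl)// mulrN1z mulNr mul1r => <-.
by congr l; apply/funext => x; rewrite mulN1r.
Qed.

Lemma pfN f : lc f -> l (fun x => - f x) = - l f.
Proof.
move=> lf; have := pfZ pl (-1) lf; rewrite mulrN1z mulN1r => <-.
by congr l; apply/funext => x; rewrite mulN1r.
Qed.

Lemma pf_le f g : lc f -> lc g -> (forall x, f x <= g x) -> l f <= l g.
Proof.
move=> lf lg fg; rewrite -subr_ge0 -pfB//; apply: (pf_ge0 pl).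
  exact: lc_intB.
by move=> x; rewrite subr_ge0.
Qed.

Lemma pf_cst (k : int) : l (fun=> k) = k%:~R.
Proof.
have := pfZ pl k (@lc_cst X _ (1 : int)); by rewrite (pf1 pl) !mulr1.
Qed.

Lemma pf_ind_ge0 a : lc a -> 0 <= l (ind a).
Proof. by move=> la; apply: (pf_ge0 pl) => //; exact: lc_ind. Qed.

Lemma pf_sub a b : lc a -> lc b -> (forall x, a x -> b x) ->
  l (ind a) <= l (ind b).
Proof.
move=> la lb ab; apply: pf_le; try exact: lc_ind.
by move=> x; rewrite /ind lez_nat; case: (a x) (ab x) => // ->.
Qed.

Lemma pf_diff a b : lc a -> lc b -> (forall x, b x -> a x) ->
  l (ind (fun x => a x && ~~ b x)) = l (ind a) - l (ind b).
Proof.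
move=> la lb ba; rewrite -pfB; try exact: lc_ind.
congr l; apply/funext => x; rewrite /ind.
by case: (a x) (b x) (ba x) => [] [] // /(_ isT).
Qed.

Lemma pf_disjU a b : lc a -> lc b -> (forall x, a x -> ~~ b x) ->
  l (ind (fun x => a x || b x)) = l (ind a) + l (ind b).
Proof.
move=> la lb ab; rewrite -(pfD pl); try exact: lc_ind.
congr l; apply/funext => x; rewrite /ind.
by case: (a x) (b x) (ab x) => [] [] // /(_ isT).
Qed.

Lemma pf_empty a : (forall x, ~~ a x) -> l (ind a) = 0.
Proof.
move=> a0; rewrite -[RHS]pf0; congr l; apply/funext => x.
by rewrite /ind (negbTE (a0 x)).
Qed.

(** Finite additivity over fibres. The two sides are cut along different functions [e] and [e'], so
    that distinct but equimeasurable atoms can be compared. *)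
Lemma pf_fibers (T : countType) (f g : X -> int) (e e' : X -> T) :
  lc f -> lc g -> lc e -> lc e' ->
  (forall w, l (fun x => ind (fun x => e x == w) x * f x) =
             l (fun x => ind (fun x => e' x == w) x * g x)) ->
  l f = l g.
Proof.
move=> lf lg le le' H.
have lm (h : X -> int) (u : X -> T) (ws : seq T) : lc h -> lc u ->
    lc (fun x => ind (fun x => u x \in ws) x * h x).
  by move=> lh lu; apply: (lc_comp2 (fun (t : T) k => (t \in ws)%:Z * k)).
have key (ws : seq T) : l (fun x => ind (fun x => e x \in ws) x * f x) =
                        l (fun x => ind (fun x => e' x \in ws) x * g x).
  elim: ws => [|w ws IH].
    by congr l; apply/funext => x; rewrite /ind !in_nil !mul0r.
  have [win|wout] := boolP (w \in ws).
    have E (u : X -> T) : ind (fun x => u x \in w :: ws) =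
        ind (fun x => u x \in ws).
      apply/funext => x; rewrite /ind inE; case: eqP => //= ->.
      by rewrite win.
    by rewrite !E.
  have E (u : X -> T) (h : X -> int) : lc u -> lc h ->
      l (fun x => ind (fun x => u x \in w :: ws) x * h x) =
      l (fun x => ind (fun x => u x == w) x * h x) +
      l (fun x => ind (fun x => u x \in ws) x * h x).
    move=> lu lh; rewrite -(pfD pl); last exact: lm.
      congr l; apply/funext => x; rewrite /ind inE -mulrDl.
      by case: eqP => //= ->; rewrite (negbTE wout).
    by apply: (lc_comp2 (fun (t : T) k => (t == w)%:Z * k)).
  by rewrite !E// H IH.
have [ws1 H1] := fin_range cX le.
have [ws2 H2] := fin_range cX le'.
have := key (ws1 ++ ws2).
by congr (_ = _); congr l; apply/funext => x;
  rewrite /ind mem_cat ?H1 ?H2 ?orbT mul1r.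
Qed.

End PosFunctional.

(** * Homeomorphisms, clopen enumerations and good families *)

Section HomeoOps.
Context (X : topologicalType).

Definition homeo_id : homeo X X :=
  @Homeo X X id id (fun _ => erefl) (fun _ => erefl)
    (fun _ => cvg_id) (fun _ => cvg_id).

Definition homeo_sym (g : homeo X X) : homeo X X :=
  @Homeo X X (homeo_inv g) g (@homeo_invK _ _ g) (@homeo_funK _ _ g)
    (@homeo_inv_continuous _ _ g) (@homeo_continuous _ _ g).

Definition homeo_comp (g h : homeo X X) : homeo X X.
Proof.
apply: (@Homeo X X (g \o h) (homeo_inv h \o homeo_inv g)).
- exact: can_comp (@homeo_funK _ _ g) (@homeo_funK _ _ h).
- exact: can_comp (@homeo_invK _ _ h) (@homeo_invK _ _ g).
- move=> x; apply: continuous_comp; exact: homeo_continuous.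
- move=> x; apply: continuous_comp; exact: homeo_inv_continuous.
Defined.

Lemma homeo_inj (g : homeo X X) : injective g.
Proof. exact: can_inj (@homeo_funK _ _ g). Qed.

End HomeoOps.

(** What is used of the Cantor space, along with its being infinite: a compact space whose clopen
    sets are countable in number, form a basis and separate points. *)
Record clopen_enum (X : topologicalType) (cl : nat -> X -> bool) : Prop := {
  ce_compact : compact [set: X];
  ce_lc : forall n, lc (cl n);
  ce_surj : forall a : X -> bool, lc a -> exists n, cl n = a;
  ce_nbhs : forall x U, nbhs x U -> exists n, cl n x /\ forall y, cl n y -> U y;
  ce_sep : forall x y, (forall n, cl n x = cl n y) -> x = y
}.

Record good_family (R : realType) (X : topologicalType) (I : Type)
    (L : I -> (X -> int) -> R) : Prop := {
  gf_inh : inhabited I;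
  gf_pf : forall i, pos_functional (L i);
  gf_pos : forall i (a : X -> bool), lc a -> (exists x, a x) -> 0 < L i (ind a);
  gf_good : forall a b : X -> bool, lc a -> lc b ->
    (forall i, L i (ind a) < L i (ind b)) ->
    exists c : X -> bool, [/\ lc c, forall x, c x -> b x &
      forall i, L i (ind c) = L i (ind a)]
}.

Definition preserves (R : realType) (X : topologicalType) (I : Type)
    (L : I -> (X -> int) -> R) (g : X -> X) : Prop :=
  forall i f, lc f -> L i (fun x => f (g x)) = L i f.

Lemma preserves_ind (R : realType) (X : topologicalType) (I : Type)
    (L : I -> (X -> int) -> R) (g : X -> X) :
  compact [set: X] -> (forall i, pos_functional (L i)) -> continuous g ->
  (forall i (a : X -> bool), lc a -> L i (ind (fun x => a (g x))) = L i (ind a)) ->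
  preserves L g.
Proof.
move=> cX pL cg H i f lf.
have lfg := lc_precomp cg lf.
apply: (pf_fibers cX (pL i) lfg lf lfg lf) => w.
have E (h : X -> int) : lc h ->
    L i (fun x => ind (fun x => h x == w) x * h x) =
    w%:~R * L i (ind (fun x => h x == w)).
  move=> lh; rewrite -(pfZ (pL i)); last first.
    exact: (lc_comp (fun k : int => (k == w)%:Z)).
  congr (L i _); apply/funext => x; rewrite /ind.
  by case: eqP => [->|_]; rewrite ?mul1r ?mulr1 ?mul0r ?mulr0.
rewrite !E// (H _ (fun x => f x == w))//.
exact: (lc_comp (fun k : int => k == w)).
Qed.

(** * Back-and-forth between equivalent clopen sets *)

Section BackAndForth.
Context (R : realType) (X : topologicalType) (I : Type).
Context (L : I -> (X -> int) -> R) (cl : nat -> X -> bool).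
Hypothesis (eX : clopen_enum cl) (gL : good_family L).
Implicit Types (a b c d u : X -> bool) (f : X -> int).

Let cX := ce_compact eX.
Let pL := gf_pf gL.

Lemma continuous_cl (g : X -> X) : (forall n, lc (fun x => cl n (g x))) -> continuous g.
Proof.
move=> lg x U /(ce_nbhs eX) [n [nx nU]].
by apply: filterS (lg n x) => y; rewrite nx => /nU.
Qed.

(** Goodness asks for a strict inequality. By full support it holds when [a] is a proper subset of
    [u]; when [a = u], the set [u'] itself will do. *)
Lemma good_sub u (u' : X -> bool) a : lc u -> lc u' -> lc a -> (forall x, a x -> u x) ->
  (forall i, L i (ind u) = L i (ind u')) ->
  exists c : X -> bool, [/\ lc c, forall x, c x -> u' x &
    forall i, L i (ind c) = L i (ind a)].
Proof.
move=> lu lu' la au uu'.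
have [[x0 /andP[ux0 ax0]]|noex] := pselect (exists x, u x && ~~ a x).
  apply: (gf_good gL) => // i; rewrite -uu' -subr_gt0 -(pf_diff (pL i))//.
  apply: (gf_pos gL); first exact: lc_diff.
  by exists x0; rewrite ux0.
exists u'; split => // i; rewrite -uu'; congr (L i (ind _)).
apply/funext => x; apply/idP/idP => [ux|/au//].
by apply/negPn/negP => ax; apply: noex; exists x; rewrite ux.
Qed.

Definition itin (s : seq (X -> bool)) (x : X) : seq bool :=
  [seq p x | p <- s].

(** A finite partial isomorphism between clopen algebras: the fibres of [itin] are the atoms, and
    corresponding atoms are equimeasurable for the whole family. *)
Definition matched (s : seq ((X -> bool) * (X -> bool))) : Prop :=
  [/\ lc (itin (unzip1 s)), lc (itin (unzip2 s)) &
      forall w i, L i (ind (fun x => itin (unzip1 s) x == w)) =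
                  L i (ind (fun x => itin (unzip2 s) x == w))].

Definition swap_pairs (s : seq ((X -> bool) * (X -> bool))) :=
  [seq (p.2, p.1) | p <- s].

Lemma matched_swap s : matched s -> matched (swap_pairs s).
Proof.
have E1 : unzip1 (swap_pairs s) = unzip2 s by rewrite /unzip1 -map_comp.
have E2 : unzip2 (swap_pairs s) = unzip1 s by rewrite /unzip2 -map_comp.
by case=> l1 l2 H; split; rewrite ?E1 ?E2// => w i; rewrite H.
Qed.

(** Goodness splits each atom on the right as [a] splits its partner on the left; the pieces [F w]
    are then glued into one set [c]. *)
Lemma matched_extend s a : matched s -> lc a ->
  exists c, matched ((a, c) :: s).
Proof.
move=> [l1 l2 H] la.
pose u w x := itin (unzip1 s) x == w.
pose u' w x := itin (unzip2 s) x == w.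
have lu w : lc (u w) by exact: (lc_comp (fun t => t == w)).
have lu' w : lc (u' w) by exact: (lc_comp (fun t => t == w)).
have /choice[F HF] w := @good_sub (u w) (u' w) (fun x => u w x && a x)
   (lu w) (lu' w) (lc_andb (lu w) la) (fun x => @andP _ _ \; @proj1 _ _) (H w).
pose c x := F (itin (unzip2 s) x) x.
have lcc : lc c by apply: lc_diag => // w; case: (HF w).
have cE w x : u' w x && c x = F w x.
  rewrite /u' /c; case: eqP => [->//|/eqP nw] /=.
  by apply/esym/negbTE/negP; case: (HF w) => _ + _ => /[apply]; exact/negP.
exists c; split.
- exact: (lc_comp2 cons).
- exact: (lc_comp2 cons).
move=> w i; case: w => [|v w].
  by rewrite !(pf_empty (pL i))//= => x; rewrite /itin.
have E1 : (fun x => itin (unzip1 ((a, c) :: s)) x == v :: w) =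
    if v then (fun x => u w x && a x) else (fun x => u w x && ~~ (u w x && a x)).
  by case: (v); apply/funext => x;
    rewrite /u /= eqseq_cons -/(itin _ _); case: (a x); case: (_ == w).
have E2 : (fun x => itin (unzip2 ((a, c) :: s)) x == v :: w) =
    if v then F w else (fun x => u' w x && ~~ F w x).
  by case: (v); apply/funext => x;
    rewrite -cE /u' /= eqseq_cons -/(itin _ _); case: (c x); case: (_ == w).
have [lF Fu HFw] := HF w.
rewrite E1 E2; case: v {E1 E2}; first by rewrite HFw.
rewrite !(pf_diff (pL i))//; first by rewrite HFw H.
  exact: lc_andb.
by move=> x /andP[].
Qed.

Lemma matched_extend2 s n : matched s ->
  exists c c', matched ((c', cl n) :: (cl n, c) :: s).
Proof.
move=> /matched_extend /(_ (ce_lc eX n))[c /matched_swap].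
move=> /matched_extend /(_ (ce_lc eX n))[c' /matched_swap /= m].
exists c, c'; congr (matched (_ :: _ :: _)): m.
by rewrite /swap_pairs -map_comp -[RHS]map_id; apply: eq_map => -[].
Qed.

Lemma matched_head a b s : matched ((a, b) :: s) ->
  forall i, L i (ind a) = L i (ind b).
Proof.
move=> [l1 l2 H] i.
have la : lc a by exact: (lc_comp (head false) l1).
have lb : lc b by exact: (lc_comp (head false) l2).
apply: (pf_fibers cX (pL i) (lc_ind la) (lc_ind lb) l1 l2) => w.
have E (u : X -> bool) (t : seq (X -> bool)) : lc (itin (u :: t)) ->
    L i (fun x => ind (fun x => itin (u :: t) x == w) x * ind u x) =
    (head false w)%:Z%:~R * L i (ind (fun x => itin (u :: t) x == w)).
  move=> lut; rewrite -(pfZ (pL i)); last first.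
    exact: (lc_comp (fun k => (k == w)%:Z)).
  congr (L i _); apply/funext => x; rewrite /ind.
  by case: eqP => [<-|_] /=; rewrite ?mul1r ?mulr1 ?mul0r ?mulr0.
by rewrite !E// H.
Qed.

(** The partner of [x] lies in a decreasing sequence of clopen atoms. Each is nonempty, because the
    corresponding atom contains [x] and so has positive measure. *)
Lemma nested_partner (s : nat -> seq ((X -> bool) * (X -> bool))) :
  (forall n, matched (s n)) ->
  (forall n, exists p q, s n.+1 = p :: q :: s n) ->
  forall x, exists y, forall n, itin (unzip1 (s n)) x = itin (unzip2 (s n)) y.
Proof.
move=> ms ss x.
apply: (nested_nonempty cX
  (F := fun n y => itin (unzip1 (s n)) x = itin (unzip2 (s n)) y)).
- move=> n; have [_ l2 _] := ms n.
  have : lc (fun y => itin (unzip1 (s n)) x == itin (unzip2 (s n)) y).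
    exact: (lc_comp (fun t => itin (unzip1 (s n)) x == t)).
  move=> /lc_clopen[_]; congr closed; apply/seteqP.
  by split=> y /= /eqP.
- move=> n m; elim: m => [|m IH]; first by rewrite leqn0 => /eqP ->.
  rewrite leq_eqVlt => /orP[/eqP ->//|]; rewrite ltnS => /IH h.
  have [p [q E]] := ss m; apply: subset_trans h => y /=.
  by rewrite E /= => -[].
move=> n; have [l1 l2 H] := ms n.
have [i] := gf_inh gL.
apply: contrapT => ne.
have := H (itin (unzip1 (s n)) x) i.
rewrite [RHS](pf_empty (pL i)); last first.
  by move=> y; apply/eqP => e; apply: ne; exists y; rewrite e.
move/eqP; rewrite gt_eqF//; apply: (gf_pos gL); last by exists x.
exact: (lc_comp (fun t => t == _)).
Qed.

(* Back-and-forth along the enumeration [cl] of the clopen sets. *)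
Lemma equimeasurable_homeo a b : lc a -> lc b ->
  (forall i, L i (ind a) = L i (ind b)) ->
  exists2 g : homeo X X, preserves L g & forall x, b (g x) = a x.
Proof.
move=> la lb ab.
have mab : matched [:: (a, b)].
  have lnil : lc (fun _ : X => [::] : seq bool) by exact: lc_cst.
  split; try exact: (lc_comp (fun t => [:: t])).
  move=> w i; case: w => [|v [|? ?]]; last by
    rewrite !(pf_empty (pL i))// => x; rewrite /= !eqseq_cons !andbF.
    by rewrite !(pf_empty (pL i)).
  have E (u : X -> bool) : lc u -> L i (ind (fun x => itin [:: u] x == [:: v])) =
     if v then L i (ind u) else 1 - L i (ind u).
    move=> lu; case: v; first by
      congr (L i (ind _)); apply/funext => x /=; case: (u x).
    rewrite -(pf1 (pL i)) -(pfB (pL i)); last 2 first.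
      exact: lc_cst.
      exact: lc_ind.
    congr (L i _); apply/funext => x; rewrite /ind /=; by case: (u x).
  by rewrite /= !E// ab.
(* Two pairs are added at each step. With [cl n] on the right, its preimage under [g] is the clopen
   set [c'], whence [g] is continuous; with [cl n] on the left, [c] does the same for [g']. *)
have stepP (n : nat) (s : {s | matched s}) : exists s' : {s | matched s},
    exists c c', sval s' = (c', cl n) :: (cl n, c) :: sval s.
  case: s => s ms /=; have [c [c' m]] := matched_extend2 n ms.
  by exists (exist _ _ m), c, c'.
pose step n s := sval (cid (stepP n s)).
pose S := nat_rect (fun _ => {s | matched s}) (exist _ _ mab) step.
pose s n := sval (S n).
have ms n : matched (s n) by exact: svalP.
have ss n : exists c c', s n.+1 = (c', cl n) :: (cl n, c) :: s n.
  exact: (svalP (cid (stepP n (S n)))).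
have ms' n : matched (swap_pairs (s n)) by exact: matched_swap.
have U1 t : unzip1 (swap_pairs t) = unzip2 t by rewrite /unzip1 -map_comp.
have U2 t : unzip2 (swap_pairs t) = unzip1 t by rewrite /unzip2 -map_comp.
have ss' n : exists p q, s n.+1 = p :: q :: s n.
  by have [c [c' ->]] := ss n; exists (c', cl n), (cl n, c).
have /choice[g Hg] := nested_partner ms ss'.
have [|g' Hg'] := choice (@nested_partner (fun n => swap_pairs (s n)) ms' _).
  by move=> n; have [c [c' ->]] := ss n; exists (cl n, c'), (c, cl n).
have {}Hg' y n : itin (unzip1 (s n)) (g' y) = itin (unzip2 (s n)) y.
  by have := Hg' y n; rewrite U1 U2.
have gK : cancel g g'.
  move=> x; apply: (ce_sep eX) => n; have [c [c' E]] := ss n.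
  have := Hg' (g x) n.+1; rewrite -Hg E /= => -[_ + _].
  by [].
have g'K : cancel g' g.
  move=> y; apply: (ce_sep eX) => n; have [c [c' E]] := ss n.
  have := Hg (g' y) n.+1; rewrite Hg' E /= => -[+ _ _].
  by [].
have cg : continuous g.
  apply: continuous_cl => n; have [c [c' E]] := ss n.
  have := ms n.+1; rewrite E => -[/(lc_comp (head false))/= lc' _ _].
  congr lc: lc'; apply/funext => z.
  by have := Hg z n.+1; rewrite E /= => -[-> _ _].
have cg' : continuous g'.
  apply: continuous_cl => n; have [c [c' E]] := ss n.
  have := ms n.+1; rewrite E => -[_ /(lc_comp (fun t => head false (behead t)))/= lc' _].
  congr lc: lc'; apply/funext => z.
  by have := Hg' z n.+1; rewrite E /= => -[_ -> _].
exists (Homeo gK g'K cg cg'); last by move=> x /=; have := Hg x 0 => -[].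
apply: (preserves_ind cX pL) => // i u lu.
have [n <-] := ce_surj eX lu; have [c [c' E]] := ss n.
have := ms n.+1; rewrite E => /matched_head <-; congr (L i (ind _)).
by apply/funext => z /=; have := Hg z n.+1; rewrite E /= => -[-> _ _].
Qed.

End BackAndForth.

(** * Kakutani-Rokhlin partitions *)

Section Stages.
Context (R : realType) (X : topologicalType) (I : Type).
Context (L : I -> (X -> int) -> R) (cl : nat -> X -> bool).
Hypothesis (eX : clopen_enum cl) (gL : good_family L).
Implicit Types (a b c d : X -> bool) (f s h : X -> int) (g : homeo X X).

Let cX := ce_compact eX.
Let pL := gf_pf gL.

(** Along a column [h] is the partial sum of [f] from the base upwards. Its vanishing at the top,
    where [b (g x)] holds, says that [f] has sum zero over the column. With [b] empty this is the
    coboundary equation. *)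
Definition balanced g b f : Prop := exists h,
  [/\ lc h, forall x, b (g x) -> h x = 0 & forall x, h (g x) - h x = f (g x)].

(* A homeomorphism all of whose orbits are finite and meet the clopen set [b]
   exactly once, i.e. a Kakutani-Rokhlin partition with base [b] in which the
   top of each column is sent back to its base.  The uniqueness of the meeting
   point is expressed by the retraction, its existence by the fact that every
   function is cohomologous to one supported by [b]. *)
Record stage g b : Prop := {
  st_pres : preserves L g;
  st_lc : lc b;
  st_ne : exists x, b x;
  st_proj : exists p : X -> X, [/\ continuous p, forall x, p (g x) = p x,
    forall x, b (p x) & forall x, b x -> p x = x];
  st_cob : forall f, lc f -> exists s, [/\ lc s, forall x, ~~ b x -> s x = 0 &
    balanced g b (fun x => f x - s x)]
}.

Definition extends g b g' b' : Prop :=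
  (forall x, b' x -> b x) /\ (forall x, ~~ b (g x) -> g' x = g x).

(** Off the tops [g'] copies [g], and there [g] already takes every value outside [b]; by
    injectivity only values in [b] are left for the tops. *)
Lemma extends_base g b g' b' : extends g b g' b' ->
  forall x, b (g' x) = b (g x).
Proof.
move=> [bb gg] x; have [bgx|nb] := boolP (b (g x)); last first.
  by rewrite gg// (negbTE nb).
apply/negPn/negP => nb.
pose z := homeo_inv g (g' x).
have gz : g z = g' x by rewrite /z homeo_invK.
have zx : g' z = g' x by rewrite gg// gz.
by move: nb; rewrite -gz (homeo_inj zx) bgx.
Qed.

Lemma extends_trans g b g' b' g'' b'' :
  extends g b g' b' -> extends g' b' g'' b'' -> extends g b g'' b''.
Proof.
move=> e [bb' gg']; have [bb gg] := e; split=> [x /bb' /bb //|x nb].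
by rewrite gg' ?gg//; apply: contra nb => /bb.
Qed.

Lemma extends_refl g b : extends g b g b.
Proof. by []. Qed.

(** The same [h] serves: it vanishes at the old tops, where [g'] may differ from [g], and at a base
    point it equals [f], whichever top precedes. *)
Lemma balanced_extends g b g' b' f : extends g b g' b' ->
  balanced g b f -> balanced g' b' f.
Proof.
move=> e [h [lh h0 hE]]; have [bb gg] := e.
exists h; split=> // [x /bb|x]; first by rewrite (extends_base e) => /h0.
have [bgx|nb] := boolP (b (g x)); last by rewrite gg.
rewrite (h0 x)// subr0.
pose z := homeo_inv g (g' x).
have gz : g z = g' x by rewrite /z homeo_invK.
by rewrite -gz -hE (h0 z) ?subr0// gz (extends_base e).
Qed.

Lemma balancedD g b f1 f2 : balanced g b f1 -> balanced g b f2 ->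
  balanced g b (fun x => f1 x + f2 x).
Proof.
move=> [h1 [l1 z1 E1]] [h2 [l2 z2 E2]].
exists (fun x => h1 x + h2 x); split; first exact: lc_intD.
  by move=> x bx; rewrite z1// z2.
by move=> x; rewrite -E1 -E2; ring.
Qed.

Lemma balancedN g b f : balanced g b f -> balanced g b (fun x => - f x).
Proof.
move=> [h [l z E]]; exists (fun x => - h x); split.
- exact: (lc_comp -%R).
- by move=> x bx; rewrite z// oppr0.
by move=> x; rewrite -E; ring.
Qed.

Lemma balanced_pf g b f : preserves L g -> lc f -> balanced g b f ->
  forall i, L i f = 0.
Proof.
move=> pg lf [h [lh _ hE]] i.
have lg T (k : X -> T) : lc k -> lc (fun x => k (g x)).
  by apply: lc_precomp; exact: homeo_continuous.
rewrite -(pg i f lf).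
under eq_fun do rewrite -hE.
by rewrite (pfB (pL i))// ?pg ?subrr//; exact: lg.
Qed.

Lemma swap_homeo c d : lc c -> lc d -> (forall x, c x -> ~~ d x) ->
  (forall i, L i (ind c) = L i (ind d)) ->
  exists t : homeo X X, [/\ preserves L t, forall x, t (t x) = x,
    forall x, c (t x) = d x, forall x, d (t x) = c x &
    forall x, ~~ c x -> ~~ d x -> t x = x].
Proof.
move=> lcc ld cd Lcd.
have [q pq qE] := equimeasurable_homeo eX gL lcc ld Lcd.
pose q' := homeo_inv q.
have qK : cancel q q' := @homeo_funK _ _ q.
have q'K : cancel q' q := @homeo_invK _ _ q.
have q'E x : c (q' x) = d x by rewrite -qE q'K.
have dc x : d x -> c x = false by apply: contraTF => /cd.
pose t x := if c x then q x else if d x then q' x else x.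
have tt x : t (t x) = x.
  rewrite /t; have [cx|ncx] := boolP (c x).
    by rewrite dc qE// cx qK.
  have [dx|ndx] := boolP (d x); first by rewrite q'E dx q'K.
  by rewrite (negbTE ncx) (negbTE ndx).
have ct : continuous t.
  apply: continuous_if => //; first exact: homeo_continuous.
  apply: continuous_if => //; first exact: homeo_inv_continuous.
  by move=> ?; exact: cvg_id.
have ctd x : c (t x) = d x.
  rewrite /t; have [cx|ncx] := boolP (c x).
    by rewrite dc ?qE// ; apply/esym/negbTE; exact: cd.
  have [dx|ndx] := boolP (d x); first by rewrite q'E dx.
  by rewrite (negbTE ncx).
exists (@Homeo X X t t tt tt ct ct); split => //=; last 2 first.
- by move=> x; rewrite -ctd tt.
- by move=> x /negbTE cx /negbTE dx; rewrite /t cx dx.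
move=> i f lf.
pose f1 x := if d x then f x else 0.
pose f2 x := if c x then f x else 0.
pose f3 x := if c x || d x then 0 else f x.
have l1 : lc f1 by exact: (lc_comp2 (fun (u : bool) v => if u then v else 0)).
have l2 : lc f2 by exact: (lc_comp2 (fun (u : bool) v => if u then v else 0)).
have l3 : lc f3.
  exact: (lc_comp3 (fun (u v : bool) k => if u || v then 0 else k)).
have l1q : lc (fun x => f1 (q x)).
  by apply: lc_precomp => //; exact: homeo_continuous.
have l2q : lc (fun x => f2 (q' x)).
  by apply: lc_precomp => //; exact: homeo_inv_continuous.
have pq' : L i (fun x => f2 (q' x)) = L i f2.
  rewrite -(pq _ _ l2q); congr (L i _); apply/funext => x.
  by rewrite qK.
transitivity (L i f1 + L i f2 + L i f3).
  rewrite -(pq i f1)// -pq' -!(pfD (pL i))//; last exact: lc_intD.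
  congr (L i _); apply/funext => x; rewrite /f1 /f2 /f3 /t qE q'E.
  have [cx|ncx] := boolP (c x).
    by rewrite (negbTE (cd _ cx)) /= !addr0.
  by have [dx|ndx] := boolP (d x); rewrite /= ?add0r ?addr0.
rewrite -!(pfD (pL i))//; last exact: lc_intD.
congr (L i _); apply/funext => x; rewrite /f1 /f2 /f3.
have [cx|ncx] := boolP (c x); first by rewrite (negbTE (cd _ cx)) /= add0r addr0.
by have [dx|ndx] := boolP (d x); rewrite /= ?add0r ?addr0.
Qed.

Lemma preserves_comp g g' : preserves L g -> preserves L g' ->
  preserves L (homeo_comp g g').
Proof.
move=> pg pg' i f lf /=; rewrite (pg' i (fun x => f (g x))) ?pg//.
by apply: lc_precomp => //; exact: homeo_continuous.
Qed.

Lemma preserves_sym g : preserves L g -> preserves L (homeo_sym g).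
Proof.
move=> pg i f lf /=; rewrite -[LHS]pg.
  by congr (L i _); apply/funext => x; rewrite homeo_funK.
by apply: lc_precomp => //; exact: homeo_inv_continuous.
Qed.

(* Put each column over [d] on top of a column over [c]. *)
Lemma stage_stack g b c d : stage g b -> lc c -> lc d ->
  (forall x, c x -> b x) -> (forall x, d x -> b x) ->
  (forall x, c x -> ~~ d x) -> (forall i, L i (ind c) = L i (ind d)) ->
  exists g', let b' x := b x && ~~ d x in
  [/\ stage g' b', extends g b g' b' &
    forall s, lc s -> (forall x, ~~ b x -> s x = 0) -> exists s',
    [/\ lc s', forall x, ~~ b' x -> s' x = 0,
      balanced g' b' (fun x => s x - s' x),
      forall x, b' x -> ~~ c x -> s' x = s x &
      forall x, c x -> exists2 z, d z & s' x = s x + s z]].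
Proof.
move=> sg lcc ld cb db cd Lcd.
have [t [pt tt ctd dtc tid]] := swap_homeo lcc ld cd Lcd.
have [pg lb [x0 bx0] [p [cp pg' bp pid]] cobg] := sg.
pose b' x := b x && ~~ d x.
have lb' : lc b' by exact: lc_diff.
have dc x : d x -> ~~ c x by apply: contraL => /cd.
have bt x : b (t x) = b x.
  have [cx|ncx] := boolP (c x); first by rewrite (cb _ cx) db// dtc.
  have [dx|ndx] := boolP (d x); first by rewrite (db _ dx) cb// ctd.
  by rewrite tid.
have pt' x : b x -> p (t x) = t x by move=> bx; rewrite pid// bt.
(* The top over a point [x] of [c] now goes to the base [t x] in [d], and the top over [t x] returns
   to [x]. *)
pose g' := homeo_comp t g.
have g'E x : g' x = t (g x) by [].
have ext : extends g b g' b'.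
  split=> [x /andP[]//|x nb]; rewrite g'E tid//.
    by apply: contra nb => /cb.
  by apply: contra nb => /db.
have stackP s : lc s -> (forall x, ~~ b x -> s x = 0) -> exists s',
    [/\ lc s', forall x, ~~ b' x -> s' x = 0,
      balanced g' b' (fun x => s x - s' x),
      forall x, b' x -> ~~ c x -> s' x = s x &
      forall x, c x -> exists2 z, d z & s' x = s x + s z].
  move=> ls s0.
  have lst : lc (fun x => s (t x)).
    by apply: lc_precomp => //; exact: homeo_continuous.
  pose s' x := if d x then 0 else if c x then s x + s (t x) else s x.
  have ls' : lc s'.
    apply: (lc_comp2 (fun (u : bool) v => if u then 0 else v)) => //.
    apply: (lc_comp3 (fun (u : bool) v k => if u then v else k)) => //.
    exact: lc_intD.
  (* The partial sums of [s - s'] over a new column: [- s (t x)] along the lower part, over [x] in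
     [c], and 0 from the base point [t x] in [d] onwards. *)
  pose k x := if c (p x) then - s (t (p x)) else 0.
  have lk : lc k.
    apply: (lc_precomp (f := fun x => if c x then - s (t x) else 0)) => //.
    apply: (lc_comp3 (fun (u : bool) v k => if u then v else k)) => //.
      exact: (lc_comp -%R).
    exact: lc_cst.
  exists s'; split => //.
  - move=> x; rewrite /s' negb_and negbK; case: ifP => //= ndx.
    by rewrite orbF => nb; rewrite (negbTE (contra (@cb x) nb)) s0.
  - exists k; split => // x; rewrite g'E.
      rewrite /b' bt dtc => /andP[bgx nc].
      by rewrite /k -pg' (pid _ bgx) (negbTE nc).
    rewrite /k -(pg' x) /s'; have [bgx|nb] := boolP (b (g x)); last first.
      have nc : ~~ c (g x) by apply: contra nb => /cb.
      have nd : ~~ d (g x) by apply: contra nb => /db.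
      by rewrite tid// (negbTE nd) (negbTE nc) !subrr.
    rewrite (pt' _ bgx) (pid _ bgx) ctd dtc tt.
    have [cx|ncx] := boolP (c (g x)).
      by rewrite (negbTE (cd _ cx)); ring.
    have [dx|ndx] := boolP (d (g x)); last by rewrite tid// !subrr.
    by ring.
  - by move=> x /andP[_ /negbTE ndx] /negbTE ncx; rewrite /s' ndx ncx.
  move=> x cx; exists (t x); first by rewrite dtc.
  by rewrite /s' (negbTE (cd _ cx)) cx.
exists g'; split => //; split => //.
- exact: preserves_comp.
- have [[x cx]|nc] := pselect (exists x, c x).
    by exists x; rewrite /b' cb//= cd.
  exists x0; rewrite /b' bx0 /=; apply/negP => dx.
  have [i] := gf_inh gL.
  have : 0 < L i (ind d) by apply: (gf_pos gL) => //; exists x0.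
  by rewrite -Lcd (pf_empty (pL i)) ?ltxx// => x; apply/negP => cx; apply: nc; exists x.
- exists (fun x => if d (p x) then t (p x) else p x); split.
  + apply: (continuous_if (c := fun x => d (p x))) => //.
      exact: lc_precomp.
    move=> x; apply: continuous_comp; first exact: cp.
    exact: homeo_continuous.
  + move=> x; rewrite g'E -(pg' x).
    have [bgx|nb] := boolP (b (g x)); last first.
      rewrite tid//; first by apply: contra nb => /cb.
      by apply: contra nb => /db.
    rewrite (pt' _ bgx) (pid _ bgx) dtc tt.
    have [cx|ncx] := boolP (c (g x)); first by rewrite (negbTE (cd _ cx)).
    by have [dx|ndx] := boolP (d (g x)) => //; rewrite tid.
  + move=> x; rewrite /b'; have [dx|ndx] := boolP (d (p x)).
      by rewrite bt bp dtc dc.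
    by rewrite bp ndx.
  + by move=> x /andP[bx ndx]; rewrite (pid _ bx) (negbTE ndx).
move=> f lf; have [s [ls s0 sb]] := cobg f lf.
have [s' [ls' s0' sb' _ _]] := stackP s ls s0.
exists s'; split => //.
have := balancedD (balanced_extends ext sb) sb'.
by congr balanced; apply/funext => x; ring.
Qed.

(** Columns read upside down: the tops become the base. Statements about bases thereby apply to
    tops. *)
Lemma stage_sym g b : stage g b ->
  stage (homeo_sym g) (fun x => b (g x)).
Proof.
move=> [pg lb [x0 bx0] [p [cp pg' bp pid]] cobg].
have lg T (k : X -> T) : lc k -> lc (fun x => k (g x)).
  by apply: lc_precomp; exact: homeo_continuous.
have lg' T (k : X -> T) : lc k -> lc (fun x => k (homeo_inv g x)).
  by apply: lc_precomp; exact: homeo_inv_continuous.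
split.
- exact: preserves_sym.
- exact: lg.
- by exists (homeo_inv g x0); rewrite homeo_invK.
- exists (fun x => homeo_inv g (p x)); split => /=.
  + move=> x; apply: continuous_comp; first exact: cp.
    exact: homeo_inv_continuous.
  + by move=> x; rewrite -(pg' (homeo_inv g x)) homeo_invK.
  + by move=> x; rewrite homeo_invK.
  + by move=> x bgx; rewrite -pg' pid// homeo_funK.
move=> f lf; have [s [ls s0 [h [lh h0 hE]]]] := cobg f lf.
exists (fun x => s (g x)); split; first exact: lg.
  by move=> x /s0.
(* The first term reverses the partial sums; the second moves the value of [s] from the base of the
   column to its top. *)
exists (fun x => - h (homeo_inv g x) + (s x - s (p x))); split => /=.
- apply: lc_intD; first by apply: (lc_comp -%R); exact: lg'.
  by apply: lc_intB => //; exact: lc_precomp.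
- move=> x; rewrite homeo_invK => bx.
  by rewrite pid// subrr addr0 h0 ?oppr0// homeo_invK.
move=> x; set y := homeo_inv g x.
have xE : x = g y by rewrite /y homeo_invK.
rewrite xE pg'.
have := hE (homeo_inv g y); rewrite homeo_invK => E.
lia.
Qed.

Lemma stage_id : stage (homeo_id X) (fun=> true).
Proof.
have [i] := gf_inh gL.
split.
- by [].
- exact: lc_cst.
- apply: contrapT => nx; have := pf1 (pL i).
  have -> : (fun=> 1) = (fun=> 0) :> (X -> int).
    by apply/funext => x; case: nx; exists x.
  by rewrite (pf0 (pL i)) => /eqP; rewrite eq_sym oner_eq0.
- by exists id; split => // x; exact: cvg_id.
move=> f lf; exists f; split => //; exists (fun=> 0); split => //.
  exact: lc_cst.
by move=> x; rewrite !subrr.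
Qed.

End Stages.

(** [df_inf] is what the construction takes from compactness of the simplex: being small compared
    with a given clopen set can be made uniform over the family, so that goodness applies. *)
Record divisible_family (R : realType) (X : topologicalType) (I : Type)
    (L : I -> (X -> int) -> R) : Prop := {
  df_good : good_family L;
  df_div : forall (a : X -> bool) (n : nat) (e : R),
    lc a -> (0 < n)%N -> 0 < e -> exists b : X -> bool,
    [/\ lc b, forall x, b x -> a x & forall i,
      L i (ind a) - e <= n%:R * L i (ind b) <= L i (ind a)];
  df_inf : forall a : X -> bool, lc a -> (exists x, a x) ->
    exists2 e : R, 0 < e & forall i, e <= L i (ind a)
}.

(** * Cutting and stacking *)

Section Construction.
Context (R : realType) (X : topologicalType) (I : Type).
Context (L : I -> (X -> int) -> R) (cl : nat -> X -> bool).
Hypothesis (eX : clopen_enum cl) (dL : divisible_family L).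
Implicit Types (a b c d r u v : X -> bool) (f s h : X -> int) (g : homeo X X).

Let cX := ce_compact eX.
Let gL := df_good dL.
Let pL := gf_pf gL.

Definition equimeasurable a b := forall i, L i (ind a) = L i (ind b).

(** Later satisfied by the invariant measures of the limit. Estimates valid for all compatible
    functionals thus pass from the simplex to such a measure. *)
Definition compatible (N : (X -> int) -> R) : Prop :=
  pos_functional N /\
  forall a b, lc a -> lc b -> equimeasurable a b -> N (ind a) = N (ind b).

Lemma compatible_family i : compatible (L i).
Proof. by split. Qed.

(** Goodness is applied [k] times, each time in the room left by the earlier copies. The count is
    stated for compatible functionals because it rests on equalities alone. *)
Lemma disjoint_copies r u k : lc r -> lc u ->
  (forall i, k%:R * L i (ind r) < L i (ind u)) ->
  exists s : seq (X -> bool), let e x := has (fun p => p x) s in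
  [/\ forall j, lc (nth (fun=> false) s j),
      forall i j, L i (ind (nth (fun=> false) s j)) <= L i (ind r),
      lc e, forall x, e x -> u x &
      forall N, compatible N -> N (ind e) = k%:R * N (ind r)].
Proof.
move=> lr lu; elim: k => [|k IH] H.
  exists [::]; split=> //=.
  - by move=> j; rewrite nth_nil; exact: lc_cst.
  - by move=> i j; rewrite nth_nil (pf_empty (pL i))// (pf_ind_ge0 (pL i)).
  - exact: lc_cst.
  - by move=> N [pN _]; rewrite (pf_empty pN)// mul0r.
have [|s [ls sr le eu eN]] := IH.
  move=> i; apply: le_lt_trans (H i).
  by rewrite ler_wpM2r ?ler_nat// (pf_ind_ge0 (pL i)).
set e := (fun x => has _ _) in le eu eN.
have lue : lc (fun x => u x && ~~ e x) by exact: lc_diff.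
have [i|c [lcc cue cr]] := gf_good gL lr lue.
  rewrite (pf_diff (pL i))// (eN _ (compatible_family i)).
  by have := H i; rewrite -natr1 mulrDl mul1r; lra.
exists (c :: s); split=> /=.
- by case.
- by move=> i [|j] //=; rewrite cr.
- exact: lc_orb.
- by move=> x /orP[/cue/andP[]|/eu].
move=> N cN; have [pN HN] := cN.
rewrite (pf_disjU pN)//; last by move=> x /cue/andP[].
rewrite (HN c r)// eN//; first by rewrite -natr1 mulrDl mul1r addrC.
Qed.

Lemma small_cover (e : R) : 0 < e -> exists s : seq (X -> bool),
  [/\ forall j, lc (nth (fun=> false) s j),
      forall i j, L i (ind (nth (fun=> false) s j)) < e &
      forall x, has (fun p => p x) s].
Proof.
move=> e0.
(* After [n - 1] copies of [r] the remainder has measure at most [2 / n]: [1 / n] for the division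
   error and [1 / n] for the missing copy. As [n >= 2], the error is below 1 and [r] has positive
   measure. *)
pose n := (Num.trunc (2 / e)).+2.
have n0 : (0 : R) < n%:R by rewrite ltr0n.
have n2 : 2 / n%:R < e.
  rewrite ltr_pdivrMr// mulrC -ltr_pdivrMr//.
  have := truncnS_gt (2 / e); move/lt_trans; apply.
  by rewrite ltr_nat.
have [|r [lr _ Hr]] := @df_div _ _ _ _ dL (fun=> true) n n%:R^-1 (@lc_cst X _ true) isT.
  by rewrite invr_gt0.
have LT i : L i (ind (fun=> true)) = 1 by exact: (pf1 (pL i)).
have r0 i : 0 < L i (ind r).
  have := Hr i; rewrite LT => /andP[+ _].
  have : n%:R^-1 < (1 : R) by rewrite invf_lt1// ltr1n.
  by move=> h1 h2; rewrite -(pmulr_rgt0 _ n0); lra.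
have nE : n%:R = n.-1%:R + 1 :> R by rewrite natr1.
have [i|s [ls sr le _ eN]] := disjoint_copies (k := n.-1) lr (@lc_cst X _ true).
  by have := Hr i; have := r0 i; rewrite LT nE mulrDl mul1r; lra.
have rn i : L i (ind r) <= n%:R^-1.
  by have := Hr i; rewrite LT -ler_pdivlMl// mulr1 => /andP[].
exists ((fun x => ~~ has (fun p => p x) s) :: s); split.
- by case=> [|j] //=; exact: lc_negb.
- move=> i [|j] /=; last first.
    apply: le_lt_trans n2; apply: le_trans (sr i j) _.
    by apply: le_trans (rn i) _; rewrite -[leLHS]mul1r ler_wpM2r ?invr_ge0 ?ler1n// ltW.
  have := pf_diff (pL i) (@lc_cst X _ true) le (fun x _ => isT).
  rewrite (eN _ (compatible_family i)) LT /= => ->.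
  have -> : n.-1%:R = n%:R - 1 :> R by rewrite nE addrK.
  by have := Hr i; have := rn i; rewrite LT; move: n2; lra.
by move=> x /=; case: has.
Qed.

(** A cover cuts the part of [b] outside [v] into pieces smaller than the infimum of the measures of
    [v]. Each is equivalent to a subset of [v]; stacking its columns onto those over this subset
    removes it from the base. *)
Lemma stage_shrink_base g b v : stage L g b -> lc v -> (exists x, v x) ->
  (forall x, v x -> b x) ->
  exists2 g', stage L g' v & extends g b g' v.
Proof.
move=> sg lv nv vb.
have [e e0 ev] := df_inf dL lv nv.
have [s [ls se sc]] := small_cover e0.
have key (k : nat) : exists g' b', [/\ stage L g' b', extends g b g' b',
    forall x, v x -> b' x &
    forall x j, (j < k)%N -> b' x -> nth (fun=> false) s j x -> v x].
  elim: k => [|k [g' [b' [sg' ex vb' H]]]]; first by exists g, b.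
  have lb' := st_lc sg'.
  pose d x := nth (fun=> false) s k x && (b' x && ~~ v x).
  have ld : lc d by apply: lc_andb => //; exact: lc_diff.
  have [i|c [lcc cv cd]] := gf_good gL ld lv.
    apply: lt_le_trans (ev i); apply: le_lt_trans (se i k).
    by apply: (pf_sub (pL i)) => // x /andP[].
  have [||||g'' [sg'' ex' _]] := stage_stack eX gL sg' lcc ld.
  - by move=> x /cv/vb'.
  - by move=> x /andP[_ /andP[]].
  - by move=> x /cv vx; rewrite /d vx !andbF.
  - by [].
  exists g'', (fun x => b' x && ~~ d x); split => //.
  - exact: extends_trans ex ex'.
  - by move=> x vx; rewrite vb'// /d vx !andbF.
  move=> x j; rewrite ltnS leq_eqVlt => /orP[/eqP ->|jk] /andP[b'x ndx].
    by move=> sx; move: ndx; rewrite /d sx b'x /= negbK.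
  exact: H.
have [g' [b' [sg' ex vb' H]]] := key (size s).
have b'E : b' = v.
  apply/funext => x; apply/idP/idP => [b'x|/vb'//].
  have /(has_nthP (fun=> false))[j js sx] := sc x.
  exact: H js b'x sx.
by exists g'; rewrite -b'E.
Qed.

Lemma stage_shrink_top g b v : stage L g b -> lc v -> (exists x, v x) ->
  (forall x, v x -> b (g x)) ->
  exists g' b', [/\ stage L g' b', extends g b g' b' &
    forall x, b' (g' x) = v x].
Proof.
move=> sg lv nv vb.
have [g' sg' ex] := stage_shrink_base (stage_sym sg) lv nv vb.
have [bb gg] := ex.
have gg' x : ~~ b (g x) -> homeo_inv g' x = g x.
  move=> nb; apply: (@homeo_inj _ g'); rewrite homeo_invK.
  by have := gg (g x); rewrite /= homeo_funK => ->.
exists (homeo_sym g'), (fun x => v (g' x)); split.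
- exact: stage_sym.
- split=> //= x /bb; have := extends_base ex x; rewrite /= homeo_invK.
  by move=> ->.
by move=> x /=; rewrite homeo_invK.
Qed.

(* The combinatorial heart (a variant of Shen's theorem on dimension groups):
   columns on which the sum of [s] is maximal are stacked with columns on which
   it is negative, which is possible since [s] has zero integral. *)
Lemma stage_balance_bounded (n p q : nat) g b s : (p + q <= n)%N ->
  stage L g b -> lc s -> (forall x, ~~ b x -> s x = 0) ->
  (forall x, - q%:Z <= s x <= p%:Z) -> (forall i, L i s = 0) ->
  exists g' b', [/\ stage L g' b', extends g b g' b' & balanced g' b' s].
Proof.
elim: n p q g b s => [|n IH] p q g b s pq sg ls s0 spq Ls.
  exists g, b; split=> //; exists (fun=> 0); split=> //; first exact: lc_cst.
  move=> x; have := spq (g x); rewrite subrr.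
  have -> : p = 0 by lia.
  have -> : q = 0 by lia.
  by rewrite oppr0 => /le_anti ->.
(* The other case follows by passing to [- s]. With [q <= p], adding the maximum [p] to a negative
   value gives a nonnegative one. *)
wlog qp : p q s pq ls s0 spq Ls / (q <= p)%N.
  move=> W; have [qp|/ltnW pq'] := leqP q p; first exact: (W p q).
  have [|||x|i||g' [b' [sg' ex /balancedN bs]]] := W q p (fun x => - s x).
  - by rewrite addnC.
  - exact: (lc_comp -%R).
  - by move=> x /s0 ->; rewrite oppr0.
  - by have := spq x; lia.
  - by rewrite (pfN (pL i))// Ls oppr0.
  - by [].
  exists g', b'; split=> //; congr balanced: bs; apply/funext => x.
  by rewrite opprK.
have [p0|p0] := posnP p; first by apply: (IH 0 0 g b s) => // x; have := spq x; lia.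
pose d x := s x == p%:Z.
pose m x := s x < 0.
have ld : lc d by exact: (lc_comp (fun k : int => k == p%:Z)).
have lm : lc m by exact: (lc_comp (fun k : int => k < 0)).
pose z x := (0 < s x < p%:Z) || (- p%:Z < s x < 0).
have lz : lc z.
  exact: (lc_comp (fun k : int => (0 < k < p%:Z) || (- p%:Z < k < 0))).
(* [F] vanishes where [s] is [p], 0 or [- p] and is positive elsewhere. So [m] has larger measure
   than [d], unless [s] takes only these three values and the measures agree. *)
pose F x := p%:Z * (ind m x - ind d x) + s x.
have lF : lc F.
  apply: lc_intD => //; apply: lc_intZ.
  by apply: lc_intB; exact: lc_ind.
have LF i : L i F = p%:R * (L i (ind m) - L i (ind d)).
  rewrite (pfD (pL i))//; last first.
    by apply: lc_intZ; apply: lc_intB; exact: lc_ind.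
  rewrite (pfZ (pL i)); last by apply: lc_intB; exact: lc_ind.
  by rewrite (pfB (pL i)) ?Ls ?addr0//; exact: lc_ind.
have Fz x : ind z x <= F x.
  have := spq x; rewrite /F /ind /z /m /d.
  by case: (ltgtP (s x) 0); case: (ltgtP (s x) p%:Z); rewrite /=;
    case: (ltP (- p%:Z) (s x)) => /=; lia.
have [c [lcc cm Lc]] : exists c, [/\ lc c, forall x, c x -> m x &
    forall i, L i (ind c) = L i (ind d)].
  have p0' : (0 : R) < p%:R by rewrite ltr0n.
  have [nz|nz] := pselect (exists x, z x).
    apply: (gf_good gL) => // i; rewrite -subr_gt0 -(pmulr_rgt0 _ p0') -LF.
    apply: lt_le_trans (gf_pos gL i lz nz) _.
    by apply: (pf_le (pL i)) => //; exact: lc_ind.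
  have F0 : F = fun=> 0.
    apply/funext => x; have : ~~ z x by apply/negP => zx; apply: nz; exists x.
    have := spq x; rewrite /F /ind /z /m /d.
    by case: (ltgtP (s x) 0); case: (ltgtP (s x) p%:Z); rewrite /=;
      case: (ltP (- p%:Z) (s x)) => /=; lia.
  exists m; split=> // i; apply/eqP; rewrite -subr_eq0.
  have := LF i; rewrite F0 (pf0 (pL i)) => /esym/eqP.
  by rewrite mulf_eq0 gt_eqF.
have sb x : s x != 0 -> b x by apply: contraR => /s0 ->.
have [||||g' [sg' ex /(_ s ls s0)]] := stage_stack eX gL sg lcc ld.
- by move=> x /cm; rewrite /m => sx; apply: sb; lia.
- by move=> x /eqP sx; apply: sb; lia.
- by move=> x /cm; rewrite /m /d => sx; lia.
- by [].
move=> [s' [ls' s'0 bs' s's s'c]].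
have Ls' i : L i s' = 0.
  have lss : lc (fun x => s x - s' x) by exact: lc_intB.
  have := balanced_pf gL (st_pres sg') lss bs' i.
  by rewrite (pfB (pL i))// Ls sub0r => /eqP; rewrite oppr_eq0 => /eqP.
(* Stacking has removed the value [p] and turned some negative values into values between 0 and
   [p - 1], so the range has shrunk by one. *)
have [|x|g'' [b'' [sg'' ex' bs'']]] := IH p.-1 q g' _ s' _ sg' ls' s'0 _ Ls'.
- by lia.
- have [nb|bx] := boolP (~~ (b x && ~~ d x)); first by rewrite s'0//; lia.
  move/negPn: (bx) => /andP[_ ndx].
  have := spq x; have [cx|ncx] := boolP (c x); last first.
    by rewrite s's//; [move: ndx; rewrite /d; lia | exact/negPn].
  have [y /eqP dy ->] := s'c x cx.
  by move: (cm _ cx); rewrite /m dy; lia.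
exists g'', b''; split => //; first exact: extends_trans ex ex'.
have := balancedD (balanced_extends ex' bs') bs''.
by congr balanced; apply/funext => x; rewrite subrK.
Qed.

Lemma stage_balance g b f : stage L g b -> lc f -> (forall i, L i f = 0) ->
  exists g' b', [/\ stage L g' b', extends g b g' b' & balanced g' b' f].
Proof.
move=> sg lf Lf; have [s [ls s0 bs]] := st_cob sg lf.
have [M HM] := lc_bounded cX ls.
have Ls i : L i s = 0.
  have := balanced_pf gL (st_pres sg) (lc_intB lf ls) bs i.
  by rewrite (pfB (pL i))// Lf sub0r => /eqP; rewrite oppr_eq0 => /eqP.
have [|g' [b' [sg' ex bs']]] := stage_balance_bounded (leqnn (M + M)) sg ls s0 _ Ls.
  by move=> x; have := HM x; lia.
exists g', b'; split => //.
have := balancedD (balanced_extends ex bs) bs'.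
by congr balanced; apply/funext => x; rewrite subrK.
Qed.

End Construction.

(** * The limit homeomorphism and its minimality *)

Section Limit.
Context (R : realType) (X : topologicalType) (I : Type).
Context (L : I -> (X -> int) -> R) (cl : nat -> X -> bool).
Hypothesis (eX : clopen_enum cl) (dL : divisible_family L).
Implicit Types (a b c d u v : X -> bool) (f s h w : X -> int) (g : homeo X X).

Let cX := ce_compact eX.
Let gL := df_good dL.
Let pL := gf_pf gL.

Definition coboundary g f := balanced g (fun=> false) f.

Definition decides u v := (forall x, v x -> u x) \/ (forall x, v x -> ~~ u x).

Lemma exists_deciding u b : lc u -> lc b -> (exists x, b x) ->
  exists v, [/\ lc v, exists x, v x, forall x, v x -> b x & decides u v].
Proof.
move=> lu lb [x bx]; have [[y /andP[by_ uy]]|nex] := pselect (exists y, b y && u y).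
  exists (fun x => b x && u x); split.
  - exact: lc_andb.
  - by exists y; rewrite by_.
  - by move=> z /andP[].
  - by left=> z /andP[].
exists b; split=> //; first by exists x.
by right=> z bz; apply/negP => uz; apply: nex; exists z; rewrite bz.
Qed.

Lemma decides_sub u v v' : (forall x, v' x -> v x) -> decides u v -> decides u v'.
Proof. by move=> vv [] H; [left|right] => x /vv /H. Qed.

Lemma decides_eq u v x y : decides u v -> v x -> v y -> u x = u y.
Proof.
move=> [] H vx vy; first by rewrite !H.
by rewrite (negbTE (H _ vx)) (negbTE (H _ vy)).
Qed.

(** The pair coded by [n] is treated at this stage only, since extensions inherit balance; shrinking
    the base, then the top, into one side of [cl n] only extends the stage further. *)
Lemma stage_refine n g b : stage L g b -> exists g' b',
  [/\ stage L g' b', extends g b g' b', decides (cl n) b',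
    decides (cl n) (fun x => b' (g' x)) &
    forall i j, unpickle n = Some (i, j) -> equimeasurable L (cl i) (cl j) ->
      balanced g' b' (fun x => ind (cl i) x - ind (cl j) x)].
Proof.
move=> sg.
have [g1 [b1 [sg1 e1 H1]]] : exists g' b', [/\ stage L g' b', extends g b g' b' &
    forall i j, unpickle n = Some (i, j) -> equimeasurable L (cl i) (cl j) ->
      balanced g' b' (fun x => ind (cl i) x - ind (cl j) x)].
  have [[[i j] [nij Lij]]|no] := pselect (exists ij : nat * nat,
      unpickle n = Some ij /\ equimeasurable L (cl ij.1) (cl ij.2)).
    have li := ce_lc eX i; have lj := ce_lc eX j.
    have [|k|g' [b' [sg' e' bal]]] := stage_balance eX dL
        (f := fun x => ind (cl i) x - ind (cl j) x) sg.
    - by apply: lc_intB; exact: lc_ind.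
    - by rewrite (pfB (pL k)) ?Lij ?subrr//; exact: lc_ind.
    exists g', b'; split=> // i' j'; rewrite nij => -[<- <-] _.
    exact: bal.
  exists g, b; split=> // i j nij Lij; exfalso; apply: no.
  by exists (i, j).
have [v [lv nv vb1 dv]] := exists_deciding (ce_lc eX n) (st_lc sg1) (st_ne sg1).
have [g2 sg2 e2] := stage_shrink_base eX dL sg1 lv nv vb1.
have lT : lc (fun x => v (g2 x)) by apply: lc_precomp => //; exact: homeo_continuous.
have [|t [lt nt tv dt]] := exists_deciding (ce_lc eX n) lT.
  have [x vx] := nv; exists (homeo_inv g2 x); by rewrite homeo_invK.
have [g3 [b3 [sg3 e3 T3]]] := stage_shrink_top eX dL sg2 lt nt tv.
exists g3, b3; split=> //.
- by apply: extends_trans e1 _; exact: extends_trans e2 e3.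
- by apply: decides_sub dv => x; exact: (proj1 e3).
- by apply: decides_sub dt => x; rewrite T3.
move=> i j nij Lij; apply: balanced_extends (H1 i j nij Lij).
exact: extends_trans e2 e3.
Qed.

Lemma extends_sym g b g' b' : extends g b g' b' ->
  extends (homeo_sym g) (fun x => b (g x)) (homeo_sym g') (fun x => b' (g' x)).
Proof.
move=> e; have [bb gg] := e; split=> [x /bb|x] /=.
  by rewrite (extends_base e).
rewrite homeo_invK => nb; apply: (@homeo_inj _ g'); rewrite homeo_invK.
by rewrite gg homeo_invK.
Qed.

(** Off the tops of stage [n] the value [G n x] is final. A point lying in the tops of all stages is
    sent to a common point of all bases, which compactness provides. *)
Lemma limit_fun (G : nat -> homeo X X) (B : nat -> X -> bool) :
  (forall n, lc (B n)) -> (forall n, exists x, B n x) ->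
  (forall n m, (n <= m)%N -> extends (G n) (B n) (G m) (B m)) ->
  exists f : X -> X, forall x n,
    if B n (G n x) then B n (f x) else f x == G n x.
Proof.
move=> lB nB eGB.
have [y By] : exists y, forall n, B n y.
  apply: (nested_nonempty cX (F := fun n => [set x | B n x])).
  - by move=> n; have /lc_clopen[] := lB n.
  - by move=> n m nm; exact: (proj1 (eGB n m nm)).
  - exact: nB.
suff /choice[f Hf] x : exists z, forall n,
    if B n (G n x) then B n z else z == G n x by exists f.
have [[n nBn]|aB] := pselect (exists n, ~~ B n (G n x)); last first.
  by exists y => n; case: ifP => // /negbT nBn; case: aB; exists n.
exists (G n x) => m; have [mn|/ltnW nm] := leqP m n.
  have e := eGB _ _ mn; case: ifP => [|/negbT nb].
    by rewrite (extends_base e).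
  by rewrite (proj2 e).
have e := eGB _ _ nm; rewrite (proj2 e)//.
case: ifP => [/(proj1 e)|//]; by rewrite (negbTE nBn).
Qed.

(** Since each [cl n] is decided on a base and on a top, both shrink to single points, which makes
    [f] and [f'] inverse to each other. Deciding also gives [cl n (f x) = cl n (G n.+1 x)], whence
    continuity. *)
Lemma limit_homeo (G : nat -> homeo X X) (B : nat -> X -> bool) :
  (forall n, stage L (G n) (B n)) ->
  (forall n m, (n <= m)%N -> extends (G n) (B n) (G m) (B m)) ->
  (forall n, decides (cl n) (B n.+1)) ->
  (forall n, decides (cl n) (fun x => B n.+1 (G n.+1 x))) ->
  exists2 g : homeo X X, preserves L g &
    forall n, extends (G n) (B n) g (fun=> false).
Proof.
move=> sG eG dB dT.
have lB n := st_lc (sG n); have nB n := st_ne (sG n).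
have [f fE] := limit_fun lB nB eG.
have [||n m nm|f' f'E] := @limit_fun (fun n => homeo_sym (G n)) (fun n x => B n (G n x)).
- by move=> n; apply: lc_precomp => //; exact: homeo_continuous.
- by move=> n; have [x Bx] := nB n; exists (homeo_inv (G n) x); rewrite homeo_invK.
- exact: extends_sym (eG n m nm).
have {}f'E y n : if B n y then B n (G n (f' y)) else f' y == homeo_inv (G n) y.
  by have := f'E y n; rewrite /= homeo_invK.
have fG x n : ~~ B n (G n x) -> f x = G n x.
  by move=> nb; have := fE x n; rewrite (negbTE nb) => /eqP.
have fB x n : B n (G n x) -> B n (f x) by move=> b; have := fE x n; rewrite b.
have f'G x n : ~~ B n x -> f' x = homeo_inv (G n) x.
  by move=> nb; have := f'E x n; rewrite (negbTE nb) => /eqP.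
have f'B x n : B n x -> B n (G n (f' x)) by move=> b; have := f'E x n; rewrite b.
have fK : cancel f f'.
  move=> x; have [[n nBn]|aB] := pselect (exists n, ~~ B n (G n x)).
    by rewrite (fG x n nBn) (f'G _ n nBn) homeo_funK.
  have {}aB n : B n (G n x) by apply/negPn/negP => nb; apply: aB; exists n.
  apply: (ce_sep eX) => n; apply: (decides_eq (dT n)); last exact: aB.
  by apply: f'B; exact: fB.
have f'K : cancel f' f.
  move=> x; have [[n nBn]|aB] := pselect (exists n, ~~ B n x).
    by rewrite (f'G x n nBn) (fG _ n) homeo_invK.
  have {}aB n : B n x by apply/negPn/negP => nb; apply: aB; exists n.
  apply: (ce_sep eX) => n; apply: (decides_eq (dB n)); last exact: aB.
  by apply: fB; exact: f'B.
have clf n x : cl n (f x) = cl n (G n.+1 x).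
  have [b|nb] := boolP (B n.+1 (G n.+1 x)); last by rewrite (fG _ _ nb).
  by apply: (decides_eq (dB n)) => //; exact: fB.
have clf' n x : cl n (f' x) = cl n (homeo_inv (G n.+1) x).
  have [b|nb] := boolP (B n.+1 x); last by rewrite (f'G _ _ nb).
  by apply: (decides_eq (dT n)); [exact: f'B|rewrite homeo_invK].
have cf : continuous f.
  apply: (continuous_cl eX) => n; under eq_fun do rewrite clf.
  apply: lc_precomp; [exact: homeo_continuous|exact: (ce_lc eX)].
have cf' : continuous f'.
  apply: (continuous_cl eX) => n; under eq_fun do rewrite clf'.
  apply: lc_precomp; [exact: homeo_inv_continuous|exact: (ce_lc eX)].
exists (Homeo fK f'K cf cf') => /=.
  apply: (preserves_ind cX pL) => // i a la.
  have [n <-] := ce_surj eX la; under eq_fun do rewrite clf.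
  have := st_pres (sG n.+1) i (f := ind (cl n)).
  by apply; exact: (lc_ind (ce_lc eX n)).
by move=> n; split=> // x /= nb; exact: fG.
Qed.

Lemma exists_saturated_homeo : exists2 g : homeo X X, preserves L g &
  forall a b, lc a -> lc b -> equimeasurable L a b ->
    coboundary g (fun x => ind a x - ind b x).
Proof.
pose S := {gb : homeo X X * (X -> bool) | stage L gb.1 gb.2}.
have stepP (n : nat) (t : S) : exists t' : S, let: (g, b) := sval t in
   let: (g', b') := sval t' in
   [/\ extends g b g' b', decides (cl n) b',
    decides (cl n) (fun x => b' (g' x)) &
    forall i j, unpickle n = Some (i, j) -> equimeasurable L (cl i) (cl j) ->
      balanced g' b' (fun x => ind (cl i) x - ind (cl j) x)].
  case: t => -[g b] /= sg; have [g' [b' [sg' e1 e2 e3 e4]]] := stage_refine n sg.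
  by exists (exist _ (g', b') sg').
pose step n t := sval (cid (stepP n t)).
pose sq := nat_rect (fun=> S)
  (exist (fun gb => stage L gb.1 gb.2) (homeo_id X, fun=> true) (stage_id gL)) step.
pose G n := (sval (sq n)).1; pose B n := (sval (sq n)).2.
have sG n : stage L (G n) (B n) by exact: (svalP (sq n)).
have HS n : [/\ extends (G n) (B n) (G n.+1) (B n.+1), decides (cl n) (B n.+1),
    decides (cl n) (fun x => B n.+1 (G n.+1 x)) &
    forall i j, unpickle n = Some (i, j) -> equimeasurable L (cl i) (cl j) ->
      balanced (G n.+1) (B n.+1) (fun x => ind (cl i) x - ind (cl j) x)].
  have := svalP (cid (stepP n (sq n))); rewrite -/(step n (sq n)).
  rewrite /G /B /=; case: (sval (sq n)) => g b.
  by case: (sval (step n (sq n))).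
have eG n m : (n <= m)%N -> extends (G n) (B n) (G m) (B m).
  elim: m => [|m IH]; first by rewrite leqn0 => /eqP ->; exact: extends_refl.
  rewrite leq_eqVlt => /orP[/eqP ->|]; first exact: extends_refl.
  by rewrite ltnS => /IH e; apply: extends_trans e _; case: (HS m).
have [||g pg gE] := limit_homeo sG eG; [by move=> n; case: (HS n)..|].
exists g => // a b la lb ab.
have [i ai] := ce_surj eX la; have [j bj] := ce_surj eX lb; subst a b.
have [_ _ _ H] := HS (pickle (i, j)).
apply: balanced_extends (gE (pickle (i, j)).+1) _.
by apply: H => //; rewrite pickleK.
Qed.

Section Saturated.
Variable g : homeo X X.
Hypothesis sat : forall a b, lc a -> lc b -> equimeasurable L a b ->
  coboundary g (fun x => ind a x - ind b x).

(** The space is cut into pieces smaller than the infimum for [u]; each is equivalent to a subset of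
    [u] and is moved there by a coboundary. These subsets may overlap, so [w] need not be an
    indicator. *)
Lemma saturated_return u : lc u -> (exists x, u x) -> exists w,
  (forall x, ~~ u x -> w x = 0) /\ coboundary g (fun x => 1 - w x).
Proof.
move=> lu nu; have [e e0 eu] := df_inf dL lu nu.
have [s [ls se sc]] := small_cover dL e0.
have key (k : nat) : exists w, (forall x, ~~ u x -> w x = 0) /\
    coboundary g (fun x => ind (fun x => has (fun p => p x) (take k s)) x - w x).
  elim: k => [|k [w [w0 cw]]].
    exists (fun=> 0); split=> //; exists (fun=> 0); split=> //; first exact: lc_cst.
    by move=> x; rewrite take0 /ind /= subrr.
  have [sk|ks] := leqP (size s) k.
    by exists w; split=> //; rewrite take_oversize ?leqW// -(take_oversize sk).
  pose d x := nth (fun=> false) s k x && ~~ has (fun p => p x) (take k s).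
  have lh : lc (fun x => has (fun p => p x) (take k s)).
    elim: k {ks d cw} => [|k IH]; first by rewrite take0; exact: lc_cst.
    have [ks|sk] := ltnP k (size s); last first.
      by rewrite take_oversize ?leqW// -(take_oversize sk).
    rewrite (take_nth (fun=> false) ks).
    under eq_fun do rewrite has_rcons.
    exact: lc_orb.
  have ld : lc d by exact: lc_diff.
  have [i|c [lcc cu cd]] := gf_good gL ld lu.
    apply: lt_le_trans (eu i); apply: le_lt_trans (se i k).
    by apply: (pf_sub (pL i)) => // x /andP[].
  exists (fun x => w x + ind c x); split.
    move=> x nux; rewrite w0// /ind; case: (c x) (cu x) => //= /(_ isT) ux.
    by rewrite ux in nux.
  have ec : equimeasurable L d c by move=> i; rewrite cd.
  have := balancedD cw (sat ld lcc ec); congr balanced; apply/funext => x.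
  rewrite (take_nth (fun=> false) ks) /ind /d has_rcons.
  by case: (nth _ _ _ _); case: (has _ _) => /=; ring.
have [w [w0 cw]] := key (size s); exists w; split=> //.
congr coboundary: cw; apply/funext => x.
by rewrite take_size /ind sc.
Qed.

(** Along a forward orbit that misses [cl n] the transfer function would grow by 1 at each step, yet
    it is bounded. *)
Lemma saturated_minimal : minimal_homeo g.
Proof.
move=> x O [y Oy] oO.
have [n [ny nO]] := ce_nbhs eX (open_nbhs_nbhs (conj oO Oy)).
have [w [w0 [h [lh _ hE]]]] := saturated_return (ce_lc eX n) (ex_intro _ y ny).
have [M HM] := lc_bounded cX lh.
suff [k Hk] : exists k : nat, cl n (iter k.+1 g x).
  exists (iter k.+1 g x); split; first exact: nO.
  by exists (Posz k.+1).
apply: contrapT => no.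
have E k : h (iter k g x) = h x + k%:Z.
  elim: k => [|k IH]; first by rewrite addr0.
  have := hE (iter k g x); rewrite IH -iterS.
  rewrite w0; last by apply/negP => c; apply: no; exists k.
  by lia.
have := E (M + M).+1; have := HM x; have := HM (iter (M + M).+1 g x).
by lia.
Qed.

End Saturated.

End Limit.

(** * Functionals that respect equivalence of clopen sets *)

Section Compatible.
Context (R : realType) (X : topologicalType) (I : Type).
Context (L : I -> (X -> int) -> R) (cl : nat -> X -> bool).
Hypothesis (eX : clopen_enum cl) (dL : divisible_family L).
Implicit Types (a b c d u v : X -> bool) (f s h w : X -> int).

Let cX := ce_compact eX.
Let gL := df_good dL.
Let pL := gf_pf gL.

Lemma compatible_le N a b : compatible L N -> lc a -> lc b ->
  (forall i, L i (ind a) < L i (ind b)) -> N (ind a) <= N (ind b).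
Proof.
move=> [pN HN] la lb ab; have [c [lcc cb ca]] := gf_good gL la lb ab.
have ac : equimeasurable L a c by move=> i; rewrite ca.
by rewrite (HN _ _ la lcc ac); exact: (pf_sub pN).
Qed.

Lemma compatible_small N a (m : nat) : compatible L N -> lc a ->
  (forall i, m%:R * L i (ind a) < 1) -> m%:R * N (ind a) <= 1.
Proof.
move=> cN la H; have [pN _] := cN.
have [i|s [_ _ le _ eN]] := disjoint_copies dL (k := m) la (@lc_cst X _ true).
  by rewrite [ltRHS](pf1 (pL i)).
rewrite -(eN N cN) -(pf1 pN).
by apply: (pf_sub pN (b := fun=> true)) => //; exact: lc_cst.
Qed.

(** Cut [u] into [T] nearly equal pieces and take [k] of them. The part of [u] that the [T] pieces
    miss is small for [N] too, because many disjoint copies of it fit into [X]. *)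
Lemma fraction u (k T : nat) (e : R) : lc u -> (k <= T)%N -> 0 < e ->
  exists a, [/\ lc a, forall x, a x -> u x & forall N, compatible L N ->
    `|T%:R * N (ind a) - k%:R * N (ind u)| <= e].
Proof.
move=> lu kT e0.
have [[x ux]|nu] := pselect (exists x, u x); last first.
  exists u; split=> // N [pN _]; rewrite (pf_empty pN) ?mulr0 ?subrr ?normr0 ?ltW//.
  by move=> x; apply/negP => ux; apply: nu; exists x.
have [T0|T0] := posnP T.
  exists u; split=> // N _; have -> : k = 0 by lia.
  by rewrite T0 !mul0r subrr normr0 ltW.
(* A remainder of measure at most [1 / m] costs at most [T / m], hence at most [e]. Half of [1 / m]
   is allotted to the division error, half to [u0], whose removal leaves the strict room that
   copying demands. *)
pose m := (Num.trunc (T%:R / e)).+1.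
have Tm : T%:R / e < m%:R by exact: truncnS_gt.
have m0 : (0 : R) < m%:R by rewrite ltr0n.
have eta0 : 0 < m%:R^-1 / 2 :> R by rewrite divr_gt0 ?invr_gt0.
have [t [lt te tc]] := small_cover dL eta0.
have /(has_nthP (fun=> false))[j jt tx] := tc x.
pose u0 y := u y && nth (fun=> false) t j y.
have lu0 : lc u0 by exact: lc_andb.
have u0u y : u0 y -> u y by move=> /andP[].
have Lu0 i : 0 < L i (ind u0) < m%:R^-1 / 2.
  rewrite (gf_pos gL)//=; last by exists x; rewrite /u0 ux.
  apply: le_lt_trans (te i j); apply: (pf_sub (pL i)) => //.
  by move=> y /andP[].
have [b [lb bu Hb]] := df_div dL (lc_diff lu lu0) T0 eta0.
have Hb' i : L i (ind u) - L i (ind u0) - m%:R^-1 / 2 <= T%:R * L i (ind b) <=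
    L i (ind u) - L i (ind u0).
  by rewrite -(pf_diff (pL i) lu lu0 u0u).
have [i|s1 [_ _ l1 e1u N1]] := disjoint_copies dL (k := T) lb lu.
  by have := Hb' i; have := Lu0 i; lra.
have kTR : k%:R <= T%:R :> R by rewrite ler_nat.
have [i|s2 [_ _ l2 e2u N2]] := disjoint_copies dL (k := k) lb lu.
  have : k%:R * L i (ind b) <= T%:R * L i (ind b).
    by rewrite ler_wpM2r// (pf_ind_ge0 (pL i)).
  by have := Hb' i; have := Lu0 i; lra.
set a1 := (fun y => has _ s1) in l1 e1u N1.
set a2 := (fun y => has _ s2) in l2 e2u N2.
exists a2; split=> // N cN; have [pN _] := cN.
have ld := lc_diff lu l1.
have /(compatible_small cN ld) : forall i, m%:R * L i (ind (fun x => u x && ~~ a1 x)) < 1.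
  move=> i; rewrite -ltr_pdivlMl// mulr1 (pf_diff (pL i))//.
  rewrite (N1 _ (compatible_family dL i)).
  by have := Hb' i; have := Lu0 i; lra.
have := pf_ind_ge0 pN ld.
rewrite (pf_diff pN)// (N1 _ cN) (N2 _ cN); set r := N (ind u) - _ => r0 rm.
have -> : T%:R * (k%:R * N (ind b)) - k%:R * N (ind u) = - (k%:R * r).
  by rewrite /r; ring.
rewrite normrN ger0_norm ?mulr_ge0//.
apply: (le_trans (y := T%:R * r)); first by rewrite ler_wpM2r.
rewrite -(ler_pM2l m0) mulrCA.
apply: (le_trans (y := T%:R)); first by rewrite -[leRHS]mulr1 ler_wpM2l.
by rewrite -ler_pdivrMr// ltW.
Qed.

(** [fraction] is applied to every level set of [k]; the error is shared among the listed values. *)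
Lemma fraction_fun (k : X -> nat) (T : nat) (e : R) : lc k ->
  (forall x, (k x <= T)%N) -> 0 < e ->
  exists a, lc a /\ forall N, compatible L N ->
    `|T%:R * N (ind a) - N (fun x => (k x)%:Z)| <= e.
Proof.
move=> lk kT e0; have [ws kws] := fin_range cX lk.
pose e' := e / (size ws).+1%:R.
have e'0 : 0 < e' by rewrite divr_gt0.
have lkw (vs : seq nat) : lc (fun x => ind (fun x => k x \in vs) x * (k x)%:Z).
  exact: (lc_comp (fun n : nat => (n \in vs)%:Z * n%:Z)).
have key (vs : seq nat) : exists a, [/\ lc a, forall x, a x -> k x \in vs &
    forall N, compatible L N ->
    `|T%:R * N (ind a) - N (fun x => ind (fun x => k x \in vs) x * (k x)%:Z)|
       <= e' *+ size vs].
  elim: vs => [|v vs [a [la avs aN]]].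
    exists (fun=> false); split=> //; first exact: lc_cst.
    by move=> N [pN _]; rewrite (pf_empty pN)// mulr0 subrr normr0.
  have [vin|vout] := boolP (v \in vs).
    exists a; split=> // [x /avs|N cN]; first by rewrite inE orbC => ->.
    have -> : (fun x => k x \in v :: vs) = (fun x => k x \in vs).
      by apply/funext => x; rewrite inE; case: eqP => [->|].
    by apply: le_trans (aN N cN) _; rewrite mulrS lerDr ltW.
  pose u x := k x == v.
  have lu : lc u by exact: (lc_comp (fun n => n == v)).
  (* A listed value need not be attained; truncation at [T] makes [fraction] applicable to it and
     leaves attained values unchanged. *)
  have [b [lb bu bN]] := fraction lu (geq_minr v T) e'0.
  have ab x : a x -> ~~ b x.
    by move=> /avs kx; apply: contra vout => /bu /eqP <-.
  exists (fun x => a x || b x); split; first exact: lc_orb.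
    by move=> x /orP[/avs|/bu/eqP] kx; rewrite inE kx ?orbT ?eqxx.
  move=> N cN; have [pN _] := cN; rewrite (pf_disjU pN)//.
  have -> : (fun x => ind (fun x => k x \in v :: vs) x * (k x)%:Z) =
      (fun x => ind (fun x => k x \in vs) x * (k x)%:Z + (minn v T)%:Z * ind u x).
    apply/funext => x; rewrite /ind /u inE; case: eqP => [kv|_].
      have := kT x; rewrite kv => /minn_idPl ->.
      by rewrite (negbTE vout) /=; ring.
    by rewrite mulr0 addr0.
  have lZu : lc (fun x => (minn v T)%:Z * ind u x).
    by apply: lc_intZ; exact: lc_ind.
  rewrite (pfD pN)// (pfZ pN)//; last exact: lc_ind.
  rewrite mulrDr opprD addrACA; apply: le_trans (ler_normD _ _) _.
  by rewrite [size _]/= mulrSr; apply: lerD; [exact: aN|exact: bN].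
have [a [la _ aN]] := key ws; exists a; split=> // N cN.
have := aN N cN.
have -> : (fun x => ind (fun x => k x \in ws) x * (k x)%:Z) = (fun x => (k x)%:Z).
  by apply/funext => x; rewrite /ind kws mul1r.
move=> /le_trans; apply; rewrite /e' -mulr_natr mulrAC -mulrA.
by rewrite ger_pMr// ler_pdivrMr// mul1r ler_nat.
Qed.

(** Goodness compares clopen sets only, so [f + M] and [M], divided by [T], are represented up to
    small errors by clopen sets [a] and [b]. For the family [b] is strictly smaller than [a], and
    [compatible_le] carries this over to [N]. *)
Theorem compatible_ge0 N f (e : R) : compatible L N -> lc f -> 0 < e ->
  (forall i, e <= L i f) -> 0 <= N f.
Proof.
move=> cN lf e0 Lf; have [pN _] := cN.
have [M HM] := lc_bounded cX lf.
rewrite leNgt; apply/negP => Nf.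
(* Two representations cost [2 * d], less than both [e] and [- N f]: the inequality for the family
   stays strict, and the negativity of [N f] stays visible. *)
pose d := Num.min e (- N f) / 4.
have d0 : 0 < d by rewrite divr_gt0 ?lt_min ?e0 ?oppr_gt0.
have de : d * 4 <= e by rewrite /d mulfVK ?ge_min ?lexx.
have dN : d * 4 <= - N f by rewrite /d mulfVK ?ge_min ?lexx ?orbT.
pose T := (M + M).+1; pose k x := absz (f x + M%:Z).
have T0 : (0 : R) < T%:R by rewrite ltr0n.
have lk : lc k by exact: (lc_comp (fun n : int => absz (n + M%:Z))).
have kE : (fun x => (k x)%:Z) = (fun x => f x + M%:Z).
  by apply/funext => x; have := HM x; rewrite /k; lia.
have [|a [la Ha]] := @fraction_fun k T d lk _ d0.
  by move=> x; have := HM x; rewrite /k /T; lia.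
have [|b [lb Hb]] := @fraction_fun (fun=> M) T d (@lc_cst X _ M) _ d0.
  by move=> x; rewrite /T; lia.
have kN l : pos_functional l -> l (fun x => (k x)%:Z) = l f + M%:R.
  by move=> pl; rewrite kE (pfD pl)// ?(pf_cst pl)//; exact: lc_cst.
have : N (ind b) <= N (ind a).
  apply: compatible_le => // i; rewrite -(ltr_pM2l T0).
  have := Ha _ (compatible_family dL i); rewrite kN//.
  have := Hb _ (compatible_family dL i); rewrite (pf_cst (pL i)).
  by rewrite !ler_norml; have := Lf i; lra.
rewrite -(ler_pM2l T0).
have := Ha _ cN; rewrite kN//; have := Hb _ cN; rewrite (pf_cst pN).
by rewrite !ler_norml; lra.
Qed.

End Compatible.

(** * Borel probability measures on the Cantor space *)

(** A copy of [X] whose measurable sets will be the clopen ones; the separate name keeps this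
    algebra apart from the Borel structure. *)
Definition clopen_sets (X : ptopologicalType) : Type := X.

Section ClopenAlgebra.
Context (X : ptopologicalType).

Definition clopen_display : measure_display.
Proof. by constructor. Qed.

HB.instance Definition _ := Pointed.copy (clopen_sets X) X.

Let clopenCT : setC_closed (@clopen X).
Proof. by move=> A cA; exact: clopenC. Qed.

HB.instance Definition _ := @isAlgebraOfSets.Build clopen_display
  (clopen_sets X) (@clopen X)
  (@clopen0 X) (@clopenU X) clopenCT.

Lemma measurable_clopenE (A : set (clopen_sets X)) : measurable A = clopen (A : set X).
Proof. by []. Qed.

End ClopenAlgebra.

Section ProbOfMeasure.
Context (X : ptopologicalType) (R : realType) (m : set (borel X) -> \bar R).
Hypotheses (m0 : m set0 = 0%E) (m_ge0 : forall A, (0 <= m A)%E).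
Hypotheses (m_sigma : semi_sigma_additive m) (mT : m setT = 1%E).

Let P := m.
HB.instance Definition _ := isMeasure.Build _ _ _ P m0 m_ge0 m_sigma.
HB.instance Definition _ := @Measure_isProbability.Build _ _ _ P mT.

Lemma Prob_of_measure : exists mu : Prob X R,
  forall A : set (borel X), measurable A -> mu A = m A.
Proof. exact: (Prob_of_probability P). Qed.

End ProbOfMeasure.

Section Extension.
Context (R : realType) (X : ptopologicalType) (cl : nat -> X -> bool).
Hypothesis eX : clopen_enum cl.
Implicit Types a b : X -> bool.

Lemma mem_boolset a : (fun x => x \in [set x | a x]) = a.
Proof. by apply/funext => x; apply/idP/idP; rewrite in_setE. Qed.

Variable c : (X -> bool) -> R.
Hypothesis c_ge0 : forall a, lc a -> 0 <= c a.
Hypothesis cU : forall a b, lc a -> lc b -> (forall x, a x -> ~~ b x) ->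
  c (fun x => a x || b x) = c a + c b.
Hypothesis c1 : c (fun=> true) = 1.

Definition clopen_content (A : set (clopen_sets X)) : \bar R :=
  if `[< clopen (A : set X) >] then (c (fun x => x \in (A : set X)))%:E else 0%E.

Let cc := clopen_content.

Let ccE A : clopen (A : set X) -> cc A = (c (fun x => x \in (A : set X)))%:E.
Proof. by move=> cA; rewrite /cc /clopen_content asboolT. Qed.

Let c0 : c (fun=> false) = 0.
Proof.
have := cU (@lc_cst X _ false) (@lc_cst X _ false) (fun _ _ => isT).
by move=> /eqP; rewrite -subr_eq subrr eq_sym => /eqP.
Qed.

Let cc0 : cc set0 = 0%E.
Proof.
rewrite ccE; last exact: clopen0.
congr EFin; rewrite -c0; congr c; apply/funext => x.
by rewrite in_set0.
Qed.

Let cc_ge0 A : (0 <= cc A)%E.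
Proof.
by rewrite /cc /clopen_content; case: asboolP => // cA;
  rewrite lee_fin c_ge0//; exact: clopen_lc.
Qed.

Let ccU A B : clopen (A : set X) -> clopen (B : set X) -> A `&` B = set0 ->
  cc (A `|` B) = (cc A + cc B)%E.
Proof.
move=> cA cB AB; rewrite !ccE//; last exact: clopenU.
rewrite -EFinD -cU; [|exact: clopen_lc..|].
  by congr (c _)%:E; apply/funext => x; rewrite in_setU.
move=> x xA; apply/negP => xB.
have : (A `&` B) x by split; exact/set_mem.
by rewrite AB.
Qed.

(** When a disjoint union of clopen sets is clopen, compactness shows that finitely many of them
    already cover it, so the partial sums are eventually constant. *)
Let cc_sigma_additive : semi_sigma_additive cc.
Proof.
move=> F mF tF mUF; pose U := \bigcup_n F n.
have cF n : clopen (F n : set X) by have := mF n; rewrite measurable_clopenE.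
have cFn n : clopen (\big[setU/set0]_(i < n) F i : set X).
  elim: n => [|n IH]; first by rewrite big_ord0; exact: clopen0.
  by rewrite big_ord_recr; exact: clopenU.
have [n Hn] : exists n, U `\` \big[setU/set0]_(i < n) F i = set0.
  apply: contrapT => /forallNP ne.
  have [n|n m nm|n|x Hx] := @nested_nonempty X (ce_compact eX)
    (fun n => U `\` \big[setU/set0]_(i < n) F i).
  - by apply: closedI; [case: mUF|apply: open_closedC; case: (cFn n)].
  - by apply: setDS; exact: subset_bigsetU.
  - by apply/set0P/eqP; exact: ne.
  have [[m _ Fx] _] := Hx 0; have [_] := Hx m.+1; apply.
  by rewrite big_ord_recr; right.
have E m : (\sum_(0 <= i < m) cc (F i))%E = cc (\big[setU/set0]_(i < m) F i).
  rewrite big_mkord; elim: m => [|m IH]; first by rewrite !big_ord0 cc0.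
  rewrite !big_ord_recr /= IH ccU; [by []|exact: cFn|exact: cF|].
  apply/seteqP; split=> // x [+ Fmx]; rewrite -bigcup_mkord => -[k /= km Fkx].
  have /trivIsetP/(_ k m I I) := tF; rewrite (ltn_eqF km) => /(_ isT) H.
  have : (F k `&` F m) x by [].
  by rewrite H.
apply: cvg_near_cst; exists n => // m /= nm.
rewrite E; congr cc; apply/seteqP; split=> x.
  by rewrite -bigcup_mkord => -[k _ Fkx]; exists k.
move=> Ux; have : ~ (U `\` \big[setU/set0]_(i < n) F i) x by rewrite Hn.
move=> /not_andP[//|/contrapT H]; exact: subset_bigsetU nm _ H.
Qed.

HB.instance Definition _ := isMeasure.Build _ _ _ clopen_content
  cc0 cc_ge0 cc_sigma_additive.

Let I : measurableType _ :=
  g_sigma_algebraType (@measurable _ (clopen_sets X)).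

Lemma open_clopen_sigma (O : set X) : open O ->
  <<s @clopen X >> O.
Proof.
move=> oO.
have -> : O = \bigcup_(n in [set n | forall y, cl n y -> O y]) [set x | cl n x].
  apply/seteqP; split=> [x Ox|x [n /= nO]]; last exact: nO.
  by have [n [nx nO]] := ce_nbhs eX (open_nbhs_nbhs (conj oO Ox)); exists n.
apply: (@bigcup_measurable _ I) => n _.
apply: sub_sigma_algebra; apply/lc_clopen; exact: (ce_lc eX).
Qed.

Lemma clopen_borel (A : set X) : clopen A -> measurable (A : set (borel X)).
Proof. by move=> [oA _]; exact: sub_sigma_algebra. Qed.

Let borel_clopen_sigma (A : set (borel X)) : measurable A ->
  measurable (A : set I).
Proof.
move=> mA; apply: (smallest_sub _ _ mA); first exact: smallest_sigma_algebra.
exact: open_clopen_sigma.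
Qed.

(** Carathéodory extension from the clopen sets; since countably many of them form a basis, the
    sigma-algebra they generate contains the open sets. *)
Lemma Prob_extension : exists mu : Prob X R, forall a, lc a ->
  mu [set x | a x] = (c a)%:E.
Proof.
pose m : set (borel X) -> \bar R := measure_extension clopen_content.
have mE a : lc a -> m [set x | a x] = (c a)%:E.
  move=> la; have cA : clopen [set x | a x] by exact/lc_clopen.
  transitivity (cc [set x | a x]); last by rewrite ccE// mem_boolset.
  exact: (@measurable_mu_extE _ _ _ clopen_content).
have m0 : m set0 = 0%E by exact: (@measure0 _ I).
have mge A : (0 <= m A)%E by exact: (@measure_ge0 _ I).
have mT : m setT = 1%E.
  rewrite -[RHS]/(1%:E) -c1 -mE; last exact: lc_cst.
  by congr m; apply/seteqP; split.
have ms : semi_sigma_additive m.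
  move=> F mF tF mUF.
  apply: (@measure_semi_sigma_additive _ I _ (measure_extension clopen_content)) => //.
    by move=> n; exact: borel_clopen_sigma.
  exact: borel_clopen_sigma.
have [mu Hmu] := Prob_of_measure m0 mge ms mT.
exists mu => a la; rewrite Hmu; first exact: mE.
by apply: clopen_borel; exact/lc_clopen.
Qed.

End Extension.

(** * Integrals of locally constant functions *)

Section ProbFunctional.
Context (R : realType) (X : ptopologicalType) (cl : nat -> X -> bool).
Hypothesis eX : clopen_enum cl.
Implicit Types (mu nu : Prob X R) (a b : X -> bool) (f g : X -> int).

Let cX := ce_compact eX.

Lemma lc_continuous (Y : topologicalType) (h : X -> Y) : lc h -> continuous h.
Proof.
move=> lh x U /= /nbhs_singleton Ux.
by apply: filterS (lh x) => y /= ->.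
Qed.

Lemma continuous_borel (h : X -> R) : continuous h ->
  measurable_fun setT (h : borel X -> R).
Proof.
move=> ch; apply: (measurability _ (measurable_realfun.RGenOpens.measurableE R)).
move=> _ [_ [x [y ->]] <-]; rewrite setTI.
apply: sub_sigma_algebra; apply: open_comp => [z _|]; first exact: ch.
exact: interval_open.
Qed.

Lemma continuous_integrable mu (h : X -> R) : continuous h ->
  (mu : measure _ _).-integrable setT (EFin \o (h : borel X -> R)).
Proof.
move=> ch; apply: measurable_bounded_integrable => //.
- by rewrite [ltLHS](probability_setT (Prob_measure mu)) ltry.
- exact: continuous_borel.
have /compact_bounded[M [_ mrt]] :=
  continuous_compact (continuous_subspaceT ch) cX.
exists M; split; rewrite ?num_real// => r Mr x _.
by apply: (mrt _ Mr); exists x.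
Qed.

Definition lint mu f : R := \int[mu]_x (f x)%:~R.

Lemma lc_intr_continuous f : lc f -> continuous (fun x => (f x)%:~R : R).
Proof. by move=> lf; apply: lc_continuous; exact: (lc_comp intr). Qed.

Lemma lint_pos_functional mu : pos_functional (lint mu).
Proof.
have int f : lc f -> (mu : measure _ _).-integrable setT
    (EFin \o ((fun x => (f x)%:~R) : borel X -> R)).
  by move=> lf; apply: continuous_integrable; exact: lc_intr_continuous.
split.
- move=> f g lf lg; rewrite /lint -RintegralD//; [|exact: int..].
  by apply: eq_Rintegral => x _; rewrite intrD.
- move=> k f lf; rewrite /lint -RintegralZl//; last exact: int.
  by apply: eq_Rintegral => x _; rewrite intrM.
- by move=> f lf f0; apply: Rintegral_ge0 => x _; rewrite ler0z.
by rewrite /lint Rintegral_cst//= probability_setT /= mul1r.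
Qed.

Lemma lint_ind mu a : lc a -> (lint mu (ind a))%:E = mu [set x | a x].
Proof.
move=> la; have cA : clopen [set x | a x] by exact/lc_clopen.
have mA := clopen_borel cA.
rewrite /lint /Rintegral.
rewrite (_ : (fun x => _) = fun x => (\1_([set x | a x]) x)%:E); last first.
  apply/funext => x /=; rewrite indicE /ind; congr (_%:E).
  by rewrite (_ : x \in _ = a x)// (congr1 (@^~ x) (mem_boolset a)).
rewrite integral_indic// setIT fineK//.
exact: (@fin_num_measure _ _ _ (Prob_measure mu)).
Qed.

Lemma lint_set mu (A : set X) : clopen A ->
  (lint mu (ind (fun x => x \in A)))%:E = mu A.
Proof.
move=> cA; rewrite lint_ind; last exact: clopen_lc.
by congr (Prob_measure mu _); apply/seteqP; split => x /=; rewrite in_setE.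
Qed.

Lemma Prob_eq_clopen (mu nu : Prob X R) :
  (forall a, lc a -> lint mu (ind a) = lint nu (ind a)) -> mu = nu.
Proof.
move=> H; apply: Prob_ext => A mA.
apply: (@g_sigma_algebra_measure_unique _ _ (borel X) (@clopen X) _
  (fun=> setT) _ _ (Prob_measure mu) (Prob_measure nu)).
- by move=> B cB; exact: clopen_borel.
- by move=> _; exact: clopenT.
- by rewrite bigcup_const.
- exact: clopenI.
- by move=> B cB; have := congr1 EFin (H _ (clopen_lc cB)); rewrite !lint_set.
- by move=> _; rewrite [ltLHS](probability_setT (Prob_measure mu)) ltry.
apply: (smallest_sub _ _ mA); first exact: smallest_sigma_algebra.
exact: (open_clopen_sigma eX).
Qed.

Lemma Prob_functional_continuous : continuous (@Prob_functional X R).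
Proof. exact: initial_continuous. Qed.

Lemma lint_continuous f : lc f -> continuous (fun mu => lint mu f).
Proof.
move=> lf; have ch := lc_intr_continuous lf.
pose F : continuousType X R := HB.pack (fun x => (f x)%:~R : R) (isContinuous.Build _ _ _ ch).
move=> mu.
exact: (continuous_comp (@Prob_functional_continuous mu)
  (@proj_continuous _ (fun _ => R) F _)).
Qed.

End ProbFunctional.

Lemma continuous_sqdist (R : realType) (T : topologicalType) (n : nat)
    (v : nat -> R) (u : nat -> T -> R) : (forall j, continuous (u j)) ->
  continuous (fun x => \sum_(j < n) (u j x - v j) ^+ 2).
Proof.
move=> cu; elim: n => [|n IH].
  under eq_fun do rewrite big_ord0.
  exact: cst_continuous.
under eq_fun do rewrite big_ord_recr /=.
move=> x; apply: cvgD; first exact: IH.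
apply: (@continuous_comp _ _ _ (fun x => u n x - v n) (fun y : R => y ^+ 2)).
  by apply: cvgB; [exact: cu|exact: cvg_cst].
exact: exprn_continuous.
Qed.

(** * Separation of a measure from a compact convex set *)

Section Simplex.
Context (R : realType) (X : ptopologicalType) (cl : nat -> X -> bool).
Hypothesis eX : clopen_enum cl.
Implicit Types (mu nu rho : Prob X R) (a b : X -> bool) (f : X -> int).
Implicit Type K : set (Prob X R).

Let cX := ce_compact eX.

Lemma lint_pf mu : pos_functional (lint mu).
Proof. exact: lint_pos_functional eX mu. Qed.

Lemma pf_sum (l : (X -> int) -> R) (n : nat) (t : nat -> int)
    (F : nat -> X -> int) : pos_functional l -> (forall j, lc (F j)) ->
  lc (fun x => \sum_(j < n) t j * F j x) /\
  l (fun x => \sum_(j < n) t j * F j x) = \sum_(j < n) (t j)%:~R * l (F j).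
Proof.
move=> pl lF; elim: n => [|n [lS IH]].
  under eq_fun do rewrite big_ord0.
  by rewrite big_ord0 (pf0 pl); split=> //; exact: lc_cst.
under eq_fun do rewrite big_ord_recr /=.
split; first by apply: lc_intD => //; exact: lc_intZ.
by rewrite (pfD pl)// ?IH ?big_ord_recr ?(pfZ pl)//; exact: lc_intZ.
Qed.

Lemma lint_ind_le1 mu a : lc a -> 0 <= lint mu (ind a) <= 1.
Proof.
move=> la; rewrite (pf_ind_ge0 (lint_pf mu))//= -(pf1 (lint_pf mu)).
by apply: (pf_sub (lint_pf mu) (b := fun=> true)) => //; exact: lc_cst.
Qed.

(** Clopen sets are stable under intersection and generate the Borel sets, so they determine the
    pushforward. *)
Lemma invariantP (g : X -> X) mu : continuous g ->
  invariant_measure g mu <->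
  forall a, lc a -> lint mu (ind (fun x => a (g x))) = lint mu (ind a).
Proof.
move=> cg; split=> [ig a la|H].
  have lag : lc (fun x => a (g x)) by exact: lc_precomp.
  apply: EFin_inj; rewrite !lint_ind//.
  by rewrite -(ig [set x | a x])//; apply: clopen_borel; exact/lc_clopen.
have mg A : measurable (A : set (borel X)) -> measurable (g @^-1` A : set (borel X)).
  move=> mA; rewrite -[X in measurable X]setTI.
  have : measurable_fun setT (g : borel X -> borel X).
    apply: (@measurability _ _ (borel X) (borel X) setT g (@open X) erefl).
    move=> _ [U oU <-]; rewrite setTI.
    by apply: sub_sigma_algebra; apply: open_comp => // z _; exact: cg.
  by apply.
pose m (A : set (borel X)) := mu (g @^-1` A : set (borel X)).
have m0 : m set0 = 0%E by rewrite /m preimage_set0; exact: (@measure0 _ _ _ (Prob_measure mu)).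
have mge A : (0 <= m A)%E by exact: (@measure_ge0 _ _ _ (Prob_measure mu)).
have mT : m setT = 1%E by exact: (probability_setT (Prob_measure mu)).
have ms : semi_sigma_additive m.
  move=> F mF tF mUF; rewrite /m preimage_bigcup.
  apply: (@measure_semi_sigma_additive _ _ _ (Prob_measure mu)).
  - by move=> n; exact: mg.
  - apply/trivIsetP => /= i j _ _ ij; rewrite -preimage_setI.
    by move/trivIsetP : tF => /(_ _ _ _ _ ij) ->//; rewrite preimage_set0.
  - by rewrite -preimage_bigcup; exact: mg.
have [nu Hnu] := Prob_of_measure m0 mge ms mT.
suff E : mu = nu.
  by move=> A mA; rewrite /pushforward [RHS](congr1 (fun p : Prob X R => p A) E) Hnu.
apply: (Prob_eq_clopen eX) => a la; rewrite -H//.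
apply: EFin_inj; rewrite !lint_ind//; last exact: lc_precomp.
by rewrite Hnu//; apply: clopen_borel; exact/lc_clopen.
Qed.

Lemma separating_clopens K nu : compact K -> ~ K nu -> exists N : nat,
  forall mu, K mu -> exists2 j, (j < N)%N & lint mu (ind (cl j)) != lint nu (ind (cl j)).
Proof.
move=> cK nK; have /compact_near_coveringP cov := cK.
have := @cov nat \oo (fun N mu => exists2 j, (j < N)%N &
  lint mu (ind (cl j)) != lint nu (ind (cl j))) _ _; case; last first.
  by move=> n _ /(_ n (leqnn n)) H; exists n.
move=> mu Kmu; near_simpl.
have [j nj] : exists j, lint mu (ind (cl j)) != lint nu (ind (cl j)).
  apply: contrapT => /forallNP no; apply: nK; suff <- : mu = nu by [].
  apply: (Prob_eq_clopen eX) => a la; have [n <-] := ce_surj eX la.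
  by apply/eqP/negPn/negP; exact: no.
exists ([set mu' | lint mu' (ind (cl j)) != lint nu (ind (cl j))],
   [set n | (j < n)%N]) => /=; last first.
  by case=> mu' n [/= h jn]; exists j.
split; last by exists j.+1.
have lj := lc_ind (ce_lc eX j).
have ne : nbhs (lint mu (ind (cl j))) [set r | r != lint nu (ind (cl j))].
  by apply: open_nbhs_nbhs; split=> //; exact: open_neq.
exact: (lint_continuous lj ne).
Qed.

(** The nearest-point argument, in finitely many coordinates that already separate [nu] from [K]:
    the vector [e] leads from [nu] to the nearest point [rho0]. Scaling by [T] and rounding makes
    its coefficients integers. *)
Lemma simplex_separation K nu : K !=set0 -> compact K -> convex_measures K ->
  ~ K nu -> exists f, [/\ lc f, forall mu, K mu -> 1 <= lint mu f & lint nu f < 0].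
Proof.
move=> K0 cK vK nK; have [N HN] := separating_clopens cK nK.
pose w mu j := lint mu (ind (cl j)).
pose v j := w nu j.
pose phi n mu := \sum_(j < n) (w mu j - v j) ^+ 2.
have lj j : lc (ind (cl j)) by exact: (lc_ind (ce_lc eX j)).
have cphi n : continuous (phi n).
  exact: (@continuous_sqdist R (Prob X R) n v (fun j mu => w mu j)
    (fun j => lint_continuous (lj j))).
have [rho0 /set_mem K0' min0] :=
  compact_EVT_min K0 cK (continuous_subspaceT (cphi N)).
pose e j := w rho0 j - v j.
pose eta := phi N rho0.
have eta0 : 0 < eta.
  have [j jN nj] := HN _ K0'.
  rewrite /eta /phi (bigD1 (Ordinal jN))//= ltr_pwDl//.
    by rewrite exprn_even_gt0//= subr_eq0.
  by apply: sumr_ge0 => i _; exact: sqr_ge0.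
have sep rho : K rho -> eta <= \sum_(j < N) e j * (w rho j - v j).
  move=> Kr.
  pose d j := w rho j - w rho0 j.
  pose S1 := \sum_(j < N) e j * d j.
  pose S2 := \sum_(j < N) d j ^+ 2.
  have S20 : 0 <= S2 by apply: sumr_ge0 => i _; exact: sqr_ge0.
  have St t : 0 <= t <= 1 -> 0 <= 2 * t * S1 + t ^+ 2 * S2.
    move=> t01; have [rt Krt rtE] := vK rho rho0 t Kr K0' t01.
    have wt j : w rt j = t * w rho j + (1 - t) * w rho0 j.
      apply: EFin_inj; rewrite EFinD !EFinM /w !(lint_ind _ (ce_lc eX j)).
      by apply: rtE; apply: clopen_borel; apply/lc_clopen; exact: (ce_lc eX).
    have := min0 rt (mem_set Krt); rewrite -/eta.
    have -> : phi N rt = eta + (2 * t * S1 + t ^+ 2 * S2).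
      rewrite /phi /eta /phi /S1 /S2 !mulr_sumr -!big_split /=.
      by apply: eq_bigr => j _; rewrite wt /e /d; ring.
    by rewrite lerDl.
  have S10 : 0 <= S1.
    rewrite leNgt; apply/negP => S1n.
    have S21 : 0 < S2 + 1 by rewrite ltr_wpDl.
    (* Were [S1] negative, moving slightly from [rho0] towards [rho] would come closer to [nu]; this
       [t] is small enough for the linear term to prevail. *)
    pose t := Num.min 1 (- S1 / (S2 + 1)).
    have t0 : 0 < t by rewrite lt_min ltr01 divr_gt0// oppr_gt0.
    have t1 : t <= 1 by rewrite ge_min lexx.
    have tS : t * (S2 + 1) <= - S1 by rewrite -ler_pdivlMr// ge_min lexx orbT.
    have := St t; rewrite (ltW t0) t1 => /(_ isT).
    have -> : 2 * t * S1 + t ^+ 2 * S2 = t * (2 * S1 + t * S2) by ring.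
    rewrite pmulr_rge0//; move: tS; rewrite mulrDr mulr1; lra.
  have -> : \sum_(j < N) e j * (w rho j - v j) = S1 + eta.
    rewrite /S1 /eta /phi -big_split /=; apply: eq_bigr => j _.
    by rewrite /d /e; ring.
  by rewrite lerDr.
(* Rounding [N] coefficients loses at most [N], the integer shift [q] at most 1, and 1 is to remain:
   hence [N + 2]. *)
pose T := (Num.trunc ((N%:R + 2) / eta)).+1.
have Teta : N%:R + 2 < T%:R * eta by rewrite -ltr_pdivrMr//; exact: truncnS_gt.
pose t j := Num.floor (T%:R * e j).
pose q := Num.floor (\sum_(j < N) (t j)%:~R * v j) + 1.
pose f x := (\sum_(j < N) t j * ind (cl j) x) - q.
have [_ [lS _]] : exists nu : Prob X R, _ /\ _ :=
  ex_intro _ nu (pf_sum N t (lint_pf nu) lj).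
have fE mu : lint mu f = \sum_(j < N) (t j)%:~R * w mu j - q%:~R.
  rewrite (pfB (lint_pf mu))//; last exact: lc_cst.
  by rewrite (pf_sum N t (lint_pf mu) lj).2 (pf_cst (lint_pf mu)).
have qlt : \sum_(j < N) (t j)%:~R * v j < q%:~R by exact: floorD1_gt.
have qle : q%:~R <= \sum_(j < N) (t j)%:~R * v j + 1.
  by rewrite /q intrD lerD2r floor_le_tmp.
exists f; split.
- by apply: lc_intB => //; exact: lc_cst.
- move=> mu Kmu; rewrite fE.
  have : T%:R * \sum_(j < N) e j * (w mu j - v j) - N%:R <=
      \sum_(j < N) (t j)%:~R * w mu j - \sum_(j < N) (t j)%:~R * v j.
    have -> : N%:R = \sum_(j < N) (1 : R) by rewrite sumr_const card_ord.
    rewrite mulr_sumr -!sumrB; apply: ler_sum => j _.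
    have w01 : 0 <= w mu j <= 1 := lint_ind_le1 mu (ce_lc eX j).
    have v01 : 0 <= v j <= 1 := lint_ind_le1 nu (ce_lc eX j).
    have t1 : (t j)%:~R <= T%:R * e j by exact: floor_le_tmp.
    have t2 : T%:R * e j < (t j)%:~R + 1 by rewrite -intrD1; exact: floorD1_gt.
    have : (T%:R * e j - (t j)%:~R) * (w mu j - v j) <= T%:R * e j - (t j)%:~R.
      by rewrite -[leRHS]mulr1 ler_wpM2l ?subr_ge0//; lra.
    by rewrite -mulrBr mulrA mulrBl; lra.
  have T0 : (0 : R) < T%:R by rewrite ltr0n.
  have : T%:R * eta <= T%:R * \sum_(j < N) e j * (w mu j - v j).
    by rewrite (ler_pM2l T0); exact: sep.
  by move: qle Teta; lra.
by rewrite fE subr_lt0.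
Qed.

End Simplex.

(** * Realization of a dynamical simplex *)

Section Realization.
Context (R : realType) (X : ptopologicalType) (cl : nat -> X -> bool).
Hypothesis eX : clopen_enum cl.
Variable K : set (Prob X R).
Hypothesis dK : dynamical_simplex K.
Implicit Types (mu nu rho : Prob X R) (a b : X -> bool) (f : X -> int).

Let cX := ce_compact eX.
Definition family_of (mu : {mu | K mu}) : (X -> int) -> R := lint (sval mu).

Lemma simplex_divisible_family : divisible_family family_of.
Proof.
have cE a : lc a -> clopen [set x | a x] by move=> la; exact/lc_clopen.
have posK mu a : K mu -> lc a -> (exists x, a x) -> 0 < lint mu (ind a).
  move=> Kmu la [x ax]; rewrite -lte_fin (lint_ind _)//.
  by apply: (dsimplex_full_support dK Kmu); [case: (cE _ la)|exists x].
split; first split.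
- by have [mu Kmu] := dsimplex_nonempty dK; split; exists mu.
- by move=> mu; exact: (lint_pf eX (sval mu)).
- by move=> [mu Kmu] a la na; exact: posK.
- move=> a b la lb ab.
  have [|C [cC CB CA]] := dsimplex_good dK (cE _ la) (cE _ lb).
    by move=> mu Kmu; rewrite -!(lint_ind _)// lte_fin; exact: (ab (exist _ mu Kmu)).
  exists (fun x => x \in C); split; first exact: clopen_lc.
    by move=> x /set_mem /CB.
  move=> [mu Kmu]; apply: EFin_inj; rewrite /family_of /= (lint_set _)//.
  by rewrite CA// lint_ind.
- move=> a n e la n0 e0.
  have [B [cB BA HB]] := dsimplex_approx_divisible dK (cE _ la) n0 e0.
  exists (fun x => x \in B); split; first exact: clopen_lc.
    by move=> x /set_mem /BA.
  move=> [mu Kmu]; rewrite /family_of /=.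
  have := HB mu Kmu; have <- := lint_set mu cB; have <- := lint_ind mu la.
  by rewrite -EFinB -EFinM !lee_fin.
move=> a la na.
have [mu0 /set_mem Kmu0 mn] := compact_EVT_min (dsimplex_nonempty dK)
  (dsimplex_compact dK) (continuous_subspaceT (lint_continuous (lc_ind la))).
exists (lint mu0 (ind a)); first exact: posK.
by move=> [mu Kmu]; apply: mn; exact: mem_set.
Qed.

Lemma simplex_realization : exists g : homeo X X,
  minimal_homeo g /\ K = [set mu : Prob X R | invariant_measure g mu].
Proof.
have dL := simplex_divisible_family.
have [g pg sat] := exists_saturated_homeo eX dL.
exists g; split; first exact: (saturated_minimal eX dL sat).
have cg : continuous g by exact: homeo_continuous.
apply/seteqP; split=> [mu Kmu|nu /= inu].
  apply/(invariantP eX mu cg) => a la.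
  have := pg (exist _ mu Kmu) (ind a) (lc_ind la).
  by [].
apply: contrapT => nK.
have [f [lf Kf nf]] := simplex_separation eX (dsimplex_nonempty dK)
  (dsimplex_compact dK) (dsimplex_convex dK) nK.
(* Coboundaries integrate to zero against [nu], which is therefore compatible and cannot be negative
   on a function of integral at least 1 over all of [K]. *)
have : 0 <= lint nu f; last by rewrite leNgt nf.
have pnu := lint_pf eX nu.
apply: (compatible_ge0 eX dL _ lf ltr01); last by move=> [mu Kmu]; exact: Kf.
split=> // a b la lb ab.
have [h [lh _ hE]] := sat a b la lb ab.
have inu' : preserves (fun _ : unit => lint nu) g.
  apply: (preserves_ind cX) => // _ c lc'.
  by move/(invariantP eX nu cg): inu; apply.
have lab : lc (fun x => ind a x - ind b x) by apply: lc_intB; exact: lc_ind.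
have : lint nu (fun x => ind a x - ind b x) = 0.
  rewrite -(inu' tt)//; under eq_fun do rewrite -hE.
  by rewrite (pfB pnu) ?(inu' tt) ?subrr//; apply: lc_precomp.
by rewrite (pfB pnu)//; [move/eqP; rewrite subr_eq0 => /eqP|exact: lc_ind..].
Qed.

End Realization.

(** * Clopen subsets of the Cantor space *)

Section CantorSpace.
Context (X : topologicalType) (h : homeo X cantor_space).

Let coord (n : nat) (x : X) : bool := h x n.

Lemma cantor_compact : compact [set: X].
Proof.
have -> : [set: X] = homeo_inv h @` [set: cantor_space].
  by apply/seteqP; split=> // x _; exists (h x) => //; rewrite homeo_funK.
apply: continuous_compact; last exact: cantor_space_compact.
by apply: continuous_subspaceT; exact: homeo_inv_continuous.
Qed.

Let lc_coord n : lc (coord n).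
Proof.
move=> x; have cc : continuous (coord n).
  move=> y; apply: (@continuous_comp _ _ _ h (fun u : cantor_space => u n)).
    exact: homeo_continuous.
  exact: (@proj_continuous nat (fun=> bool) n).
by apply: (cc x [set b | b = coord n x]); exact: discrete_set1.
Qed.

Let prefix (n : nat) (x : X) : seq bool := mkseq (coord^~ x) n.

Let lc_prefix n : lc (prefix n).
Proof.
rewrite /prefix; elim: n => [|n IH]; first exact: lc_cst.
under eq_fun do rewrite mkseqS.
exact: (lc_comp2 rcons).
Qed.

Let prefix_le n m x y : (n <= m)%N -> prefix m x = prefix m y ->
  prefix n x = prefix n y.
Proof.
move=> nm; rewrite -(subnKC nm) /prefix /mkseq iotaD !map_cat => /eqP.
by rewrite eqseq_cat ?size_map// => /andP[/eqP].
Qed.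

Let prefix_inj x y : (forall n, prefix n x = prefix n y) -> x = y.
Proof.
move=> H; apply: (can_inj (@homeo_funK _ _ h)); apply/funext => n.
by have := congr1 (fun s => nth false s n) (H n.+1); rewrite !nth_mkseq.
Qed.

Let prefix_nbhs x U : nbhs x U -> exists n, forall y, prefix n y = prefix n x -> U y.
Proof.
rewrite nbhsE => -[V [oV Vx] VU].
have [n | n m nm | z Hz | n Hn] := @nested_open X cantor_compact
  (fun n => [set y | prefix n y = prefix n x]) V _ _ oV _.
- have : lc (fun y => prefix n y == prefix n x) by exact: (lc_comp (fun t => t == _)).
  by move=> /lc_clopen[_]; congr closed; apply/seteqP; split=> y /= /eqP.
- by move=> z; exact: prefix_le.
- by rewrite (prefix_inj Hz).
by exists n => y /Hn /VU.
Qed.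

Let prefix_dep (a : X -> bool) : lc a ->
  exists n, forall x y, prefix n y = prefix n x -> a y = a x.
Proof.
move=> la; have /compact_near_coveringP cov := cantor_compact.
have := @cov nat \oo (fun n x => forall y, prefix n y = prefix n x -> a y = a x) _ _.
case; last first.
  by move=> n _ /(_ n (leqnn n)) H; exists n => x y; exact: H.
move=> x _; near_simpl; have [n Hn] := prefix_nbhs (la x).
exists ([set y | prefix n y = prefix n x], [set m | (n <= m)%N]) => /=.
  by split; [exact: lc_prefix|exists n].
case=> y m [/= yx nm] z zy; rewrite (Hn y yx); apply: Hn.
by rewrite -yx; exact: prefix_le zy.
Qed.

(** A clopen set is a finite union of cylinders, coded by the length and the list of the words; an
    invalid code yields the whole space. *)
Let decode (k : nat) (x : X) : bool :=
  if unpickle k is Some (n, l) then prefix n x \in (l : seq (seq bool)) else true.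

Let decode_surj (a : X -> bool) : lc a -> exists n, decode n = a.
Proof.
move=> la; have [n Hn] := prefix_dep la.
have [ws Hws] := fin_range cantor_compact (@lc_prefix n).
pose l := [seq w <- ws | `[< exists x, prefix n x = w /\ a x >]].
exists (pickle (n, l)); apply/funext => x; rewrite /decode pickleK /l.
rewrite mem_filter Hws andbT; apply/asboolP/idP => [[y [/Hn -> //]]|ax].
by exists x.
Qed.

Lemma cantor_clopen_enum : exists cl : nat -> X -> bool, clopen_enum cl.
Proof.
exists decode; split.
- exact: cantor_compact.
- move=> k; rewrite /decode; case: unpickle => [[n l]|]; last exact: lc_cst.
  exact: (lc_comp (fun t => t \in l)).
- exact: decode_surj.
- move=> x U /prefix_nbhs[n Hn].
  have [k kE] : exists k, decode k = (fun y => prefix n y == prefix n x).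
    by apply: decode_surj; exact: (lc_comp (fun t => t == _)).
  by exists k; rewrite kE eqxx; split=> // y /eqP; exact: Hn.
move=> x y H; apply: prefix_inj => n.
have [k kE] : exists k, decode k = (fun y => prefix n y == prefix n x).
  by apply: decode_surj; exact: (lc_comp (fun t => t == _)).
by have := H k; rewrite kE eqxx => /esym/eqP.
Qed.

Lemma cantor_infinite (s : seq X) : exists x, x \notin s.
Proof.
apply: contrapT => /forallNP no.
have {}no x : x \in s by apply/negPn/negP; exact: no.
pose p (i : nat) : X := homeo_inv h (fun n : nat => n == i).
have pinj : injective p.
  move=> i j /(can_inj (@homeo_invK _ _ h)) /(congr1 (fun u : cantor_space => u i)).
  by rewrite eqxx => /esym/eqP.
have := @uniq_leq_size _ (map p (iota 0 (size s).+1)) s.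
rewrite map_inj_uniq// iota_uniq size_map size_iota ltnn.
by move=> /(_ isT) H; by have := H (fun x _ => no x).
Qed.

End CantorSpace.

(** * Ultrafilter limits and weak-star convergence *)

Lemma cvg_initial (S : choiceType) (T : topologicalType) (f : S -> T)
    (F : set_system S) (s : S) : Filter F ->
  f @ F --> f s -> F --> (s : initial_topology f).
Proof.
move=> FF cvf U; rewrite nbhsE => -[B [[C oC CB] Bs] BU].
have : (f @ F) C by apply: cvf; apply: open_nbhs_nbhs; split=> //; rewrite -CB in Bs.
move=> FC; apply: (@filterS S F FF (f @^-1` C) U _ FC) => y Cy.
by apply: BU; rewrite -CB.
Qed.

Lemma cvg_prod_topology (I : Type) (T : I -> topologicalType)
    (F : set_system (prod_topology T)) (s : prod_topology T) : Filter F ->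
  (forall i, (fun f => f i) @ F --> s i) -> F --> s.
Proof. by move=> FF H; apply/cvg_sup => i; exact: cvg_initial. Qed.

Lemma ultra_cvg01 (R : realType) (T : Type) (F : set_system T) (u : T -> R) :
  UltraFilter F -> (forall t, 0 <= u t <= 1) -> exists p : R, u @ F --> p.
Proof.
move=> FU u01.
have F1 : F (u @^-1` `[0, 1]%classic).
  rewrite (_ : _ @^-1` _ = setT); first exact: filterT.
  by apply/seteqP; split=> // t _ /=; rewrite in_itv /= u01.
have [p [_ clp]] := @segment_compact R 0 1 (fmap u F) _ F1.
exists p => V pV; have [//|nV] := in_ultra_setVsetC (u @^-1` V) FU.
by have [y [] ] := clp (~` V) V nV pV.
Qed.

Lemma cvg_sum_seq (R : realType) (T J : Type) (F : set_system T) (ws : seq J)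
    (u : J -> T -> R) (v : J -> R) : Filter F ->
  (forall j, u j @ F --> v j) ->
  (fun t => \sum_(j <- ws) u j t) @ F --> \sum_(j <- ws) v j.
Proof.
move=> FF uv; elim: ws => [|w ws IH].
  by rewrite big_nil; under eq_fun do rewrite big_nil; exact: cvg_cst.
rewrite big_cons; under eq_fun do rewrite big_cons.
exact: cvgD.
Qed.

Section WeakStar.
Context (R : realType) (X : ptopologicalType) (cl : nat -> X -> bool).
Hypothesis eX : clopen_enum cl.
Implicit Types (mu nu rho : Prob X R) (a b : X -> bool) (f : X -> int).

Let cX := ce_compact eX.

(** The list of values is fixed before [l], so that limits in [l] can be taken term by term. *)
Lemma pf_decomp f : lc f -> exists ws : seq int,
  forall l : (X -> int) -> R, pos_functional l ->
  l f = \sum_(w <- ws) w%:~R * l (ind (fun x => f x == w)).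
Proof.
move=> lf; have [ws0 Hws0] := fin_range cX lf.
pose ws := undup ws0; exists ws => l pl.
have lw w : lc (ind (fun x => f x == w)) by exact: (lc_comp (fun k : int => (k == w)%:Z)).
have key (vs : seq int) : lc (fun x => \sum_(w <- vs) w * ind (fun x => f x == w) x) /\
   l (fun x => \sum_(w <- vs) w * ind (fun x => f x == w) x) =
   \sum_(w <- vs) w%:~R * l (ind (fun x => f x == w)).
  elim: vs => [|v vs [lS IH]].
    under eq_fun do rewrite big_nil.
    by rewrite big_nil (pf0 pl); split=> //; exact: lc_cst.
  under eq_fun do rewrite big_cons.
  split; first by apply: lc_intD => //; exact: lc_intZ.
  by rewrite (pfD pl)// ?IH ?big_cons ?(pfZ pl)//; exact: lc_intZ.
rewrite -(key ws).2; congr l; apply/funext => x.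
rewrite (bigD1_seq (f x)) ?undup_uniq ?mem_undup//= big1 ?addr0.
  by rewrite /ind eqxx mulr1.
by move=> w /negbTE wf; rewrite /ind eq_sym wf mulr0.
Qed.

Lemma lint_cvg (T : Type) (F : set_system T) (l : T -> (X -> int) -> R) rho f :
  Filter F -> (forall t, pos_functional (l t)) ->
  (forall a, lc a -> (fun t => l t (ind a)) @ F --> lint rho (ind a)) ->
  lc f -> (fun t => l t f) @ F --> lint rho f.
Proof.
move=> FF pl H lf; have [ws Hws] := pf_decomp lf.
rewrite (Hws _ (lint_pf eX rho)); under eq_fun do rewrite Hws//.
apply: cvg_sum_seq => w; apply: cvgMr; apply: H.
exact: (lc_comp (fun k : int => k == w)).
Qed.

(** Values in [0, 1] converge along an ultrafilter, and additivity passes to the limit, which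
    extends to a measure. This serves both for orbit averages and for compactness. *)
Lemma ultra_limit (T : Type) (F : set_system T) (l : T -> (X -> int) -> R) :
  UltraFilter F -> (forall t, pos_functional (l t)) ->
  exists rho : Prob X R, forall f, lc f -> (fun t => l t f) @ F --> lint rho f.
Proof.
move=> FU pl.
have ex a : exists p : R, lc a -> (fun t => l t (ind a)) @ F --> p.
  have [la|nla] := pselect (lc a); last by exists 0.
  have [t|p Hp] := @ultra_cvg01 R T F (fun t => l t (ind a)) FU.
    rewrite (pf_ind_ge0 (pl t))//= -(pf1 (pl t)).
    by apply: (pf_sub (pl t) (b := fun=> true)) => //; exact: lc_cst.
  by exists p.
have [c Hc] := choice ex.
have [a la|a b la lb ab||rho Hrho] := @Prob_extension R X cl eX c.
- apply: (cvgr_to_ge (Hc a la)); near=> t; exact: (pf_ind_ge0 (pl t)).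
- apply: (norm_cvg_unique (Hc _ (lc_orb la lb))).
  rewrite (_ : (fun t => _) = (fun t => l t (ind a) + l t (ind b))).
    by apply: cvgD; exact: Hc.
  by apply/funext => t; exact: (pf_disjU (pl t)).
- apply: (norm_cvg_unique (Hc _ (@lc_cst X _ true))).
  rewrite (_ : (fun t => _) = fun=> 1); first exact: cvg_cst.
  by apply/funext => t; exact: (pf1 (pl t)).
exists rho => f lf; apply: lint_cvg => // a la.
suff -> : lint rho (ind a) = c a by exact: Hc.
by apply: EFin_inj; rewrite lint_ind// Hrho.
Unshelve. all: by end_near. Qed.

(** Half of [e] is spent on replacing [h] by constants on finitely many clopen sets, half on
    rounding these to multiples of [1 / m]. *)
Lemma lc_approx (h : X -> R) (e : R) : continuous h -> 0 < e ->
  exists (f : X -> int) (m : nat), [/\ lc f, (0 < m)%N &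
    forall x, `|h x - m%:R^-1 * (f x)%:~R| <= e].
Proof.
move=> ch e0.
have e2 : 0 < e / 2 by rewrite divr_gt0.
pose Q j := exists r, forall y, cl j y -> `|h y - r| <= e / 2.
have loc x : exists j, cl j x /\ Q j.
  have [j [jx Hj]] := ce_nbhs eX (ch x _ (nbhsx_ballx (h x) (e / 2) e2)).
  by exists j; split=> //; exists (h x) => y /Hj; rewrite /= distrC => /ltW.
have [n Hn] : exists n, forall x, exists2 j, (j < n)%N & cl j x /\ Q j.
  have /compact_near_coveringP cov := cX.
  have := @cov nat \oo (fun n x => exists2 j, (j < n)%N & cl j x /\ Q j) _ _.
  case; last by move=> n _ /(_ n (leqnn n)) H; exists n => x; exact: H.
  move=> x _; near_simpl; have [j [jx Qj]] := loc x.
  exists ([set y | cl j y = cl j x], [set m | (j < m)%N]) => /=.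
    by split; [exact: (ce_lc eX j)|exists j.+1].
  by case=> y m [/= yx jm]; exists j => //; rewrite yx.
pose m := (Num.trunc (2 / e)).+1.
have m0 : (0 : R) < m%:R by rewrite ltr0n.
have me : m%:R^-1 <= e / 2.
  have te : 2 / e < m%:R by exact: truncnS_gt.
  by rewrite -[leRHS]invrK lef_pV2 ?posrE ?invr_gt0// invf_div ltW.
have /choice[r Hr] j : exists r, Q j -> forall y, cl j y -> `|h y - r| <= e / 2.
  by have [[r Hr]|nQ] := pselect (Q j); [exists r|exists 0].
pose vec x := [seq cl j x | j <- iota 0 n].
have lvec : lc vec.
  rewrite /vec; elim: (iota 0 n) => [|j s IH]; first exact: lc_cst.
  by apply: (lc_comp2 cons) => //; exact: (ce_lc eX).
(* The sets overlap; the first one that contains the point and on which [h] is nearly constant is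
   chosen, and it can be read off from [vec]. *)
pose idx (v : seq bool) := find (fun j => nth false v j && `[< Q j >]) (iota 0 n).
pose f x := Num.floor (m%:R * r (idx (vec x))).
exists f, m; split=> //.
  exact: (lc_comp (fun v => Num.floor (m%:R * r (idx v))) lvec).
move=> x; have [j jn [jx Qj]] := Hn x.
have vE i : (i < n)%N -> nth false (vec x) i = cl i x.
  by move=> i_n; rewrite (nth_map 0%N) ?size_iota// nth_iota.
have hasP' : has (fun j => nth false (vec x) j && `[< Q j >]) (iota 0 n).
  apply/hasP; exists j; first by rewrite mem_iota.
  by rewrite vE// jx; apply/asboolP.
have := nth_find 0%N hasP'; rewrite -/(idx _).
have idn : (idx (vec x) < n)%N by move: hasP'; rewrite has_find size_iota.
rewrite nth_iota// add0n vE// => /andP[cx /asboolP Qx].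
have := Hr _ Qx x cx; set q := r _ => hq.
have f1 : (f x)%:~R <= m%:R * q by exact: floor_le_tmp.
have f2 : m%:R * q < (f x)%:~R + 1 by rewrite -intrD1; exact: floorD1_gt.
have g1 : m%:R^-1 * (f x)%:~R <= q by rewrite ler_pdivrMl.
have g2 : q < m%:R^-1 * (f x)%:~R + m%:R^-1.
  by rewrite -[X in _ + X]mulr1 -mulrDr ltr_pdivlMl.
by move: hq; rewrite !ler_norml; lra.
Qed.

Lemma integral_cvg (T : Type) (F : set_system T) (l : T -> Prob X R) rho
    (h : X -> R) : Filter F ->
  (forall f, lc f -> (fun t => lint (l t) f) @ F --> lint rho f) ->
  continuous h ->
  (fun t => \int[l t]_x h x) @ F --> \int[rho]_x h x.
Proof.
move=> FF H ch; apply/cvgrPdist_le => e e0.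
have e3 : 0 < e / 3 by rewrite divr_gt0.
have [f [m [lf m0 Hf]]] := lc_approx ch e3.
have key mu : `|\int[mu]_x h x - m%:R^-1 * lint mu f| <= e / 3.
  have if_ : (mu : measure _ _).-integrable setT
     (EFin \o ((fun x => m%:R^-1 * (f x)%:~R) : borel X -> R)).
    by apply: (continuous_integrable eX); apply: lc_continuous;
      exact: (lc_comp (fun k : int => m%:R^-1 * k%:~R)).
  have if0 : (mu : measure _ _).-integrable setT
     (EFin \o ((fun x => (f x)%:~R) : borel X -> R)).
    by apply: (continuous_integrable eX); exact: lc_intr_continuous.
  have ih := continuous_integrable eX mu ch.
  have icst (c : R) : (mu : measure _ _).-integrable setT
     (EFin \o ((fun=> c) : borel X -> R)).
    by apply: (continuous_integrable eX); exact: cst_continuous.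
  have cE (c : R) : \int[mu]_x c = c.
    rewrite Rintegral_cst//.
    by rewrite [X in fine X](probability_setT (Prob_measure mu)) /= mulr1.
  rewrite /lint -RintegralZl//.
  have iD (c : R) : \int[mu]_x (m%:R^-1 * (f x)%:~R + c) =
      \int[mu]_x (m%:R^-1 * (f x)%:~R) + c.
    by rewrite RintegralD// cE.
  have i2 (c : R) : (mu : measure _ _).-integrable setT
     (EFin \o ((fun x => m%:R^-1 * (f x)%:~R + c) : borel X -> R)).
    by apply: (continuous_integrable eX); apply: lc_continuous;
      exact: (lc_comp (fun k : int => m%:R^-1 * k%:~R + c)).
  have : \int[mu]_x h x <= \int[mu]_x (m%:R^-1 * (f x)%:~R + e / 3).
    apply: le_Rintegral => // x _.
    by have := Hf x; rewrite ler_norml; lra.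
  have : \int[mu]_x (m%:R^-1 * (f x)%:~R + - (e / 3)) <= \int[mu]_x h x.
    apply: le_Rintegral => // x _.
    by have := Hf x; rewrite ler_norml; lra.
  by rewrite !iD ler_norml; lra.
have mm0 : (0 : R) < m%:R by rewrite ltr0n.
have mi : (0 : R) < m%:R^-1 by rewrite invr_gt0.
have e3m : 0 < m%:R * (e / 3) by rewrite mulr_gt0.
have /cvgrPdist_le/(_ _ e3m) := H f lf; apply: filterS => t Ht.
have : `|m%:R^-1 * lint rho f - m%:R^-1 * lint (l t) f| <= e / 3.
  by rewrite -mulrBr normrM gtr0_norm// ler_pdivrMl.
by move: (key rho) (key (l t)); rewrite !ler_norml; lra.
Qed.

Lemma Prob_cvg (F : set_system (Prob X R)) rho : Filter F ->
  (forall f, lc f -> (fun mu => lint mu f) @ F --> lint rho f) ->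
  F --> rho.
Proof.
move=> FF H; apply: (@cvg_initial _ _ (@Prob_functional X R)).
apply: cvg_prod_topology => h.
apply: (@integral_cvg _ F id rho h) => //.
exact: cts_fun.
Qed.

End WeakStar.

(** * Invariant measures of a minimal homeomorphism *)

Lemma sum_ind_has (P : nat -> bool) (N : nat) :
  (forall i j, (i < N)%N -> (j < N)%N -> P i -> P j -> i = j) ->
  \sum_(i < N) (P i)%:Z = (has P (iota 0 N))%:Z.
Proof.
elim: N => [|N IH] H; first by rewrite big_ord0.
have -> : iota 0 N.+1 = iota 0 N ++ [:: N] by rewrite -addn1 iotaD.
rewrite big_ord_recr has_cat /= orbF IH; last first.
  by move=> i j iN jN; apply: H; exact: ltnW.
case: hasP => [[i]|_] /=; last by rewrite add0r.
rewrite mem_iota add0n => /andP[_ iN] Pi; case: (boolP (P N)) => [PN|]; last by rewrite addr0.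
by have := H i N (ltnW iN) (ltnSn N) Pi PN; lia.
Qed.

Section InvariantMeasures.
Context (R : realType) (X : ptopologicalType) (cl : nat -> X -> bool).
Hypothesis eX : clopen_enum cl.
Variable g : homeo X X.
Implicit Types (mu nu rho : Prob X R) (a b u : X -> bool) (f : X -> int).

Let cX := ce_compact eX.
Let cg : continuous g := @homeo_continuous _ _ g.

Lemma lc_shift T (f : X -> T) : lc f -> lc (fun x => f (g x)).
Proof. exact: lc_precomp. Qed.

Lemma lc_iter T (f : X -> T) k : lc f -> lc (fun x => f (iter k g x)).
Proof.
move=> lf; elim: k => [//|k IH].
by under eq_fun do rewrite iterSr; exact: (lc_precomp cg IH).
Qed.

Lemma invariant_lint mu f : invariant_measure g mu -> lc f ->
  lint mu (fun x => f (g x)) = lint mu f.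
Proof.
move=> im lf.
have pr : preserves (fun _ : unit => lint mu) g.
  apply: (preserves_ind cX) => [_|//|_ a la]; first exact: (lint_pf eX).
  by move/(invariantP eX mu cg): im; apply.
exact: (pr tt).
Qed.

Lemma invariant_iter mu f k : invariant_measure g mu -> lc f ->
  lint mu (fun x => f (iter k g x)) = lint mu f.
Proof.
move=> im lf; elim: k => [//|k IH]; rewrite -IH.
rewrite -(invariant_lint im (lc_iter k lf)).
by congr lint; apply/funext => x; rewrite iterSr.
Qed.

(** Averages along the forward orbit converge along an ultrafilter. The clause on [f] remembers the
    orbit: a bound on all its partial sums becomes a bound on the integral. *)
Lemma orbit_measure x0 : exists mu : Prob X R, invariant_measure g mu /\
  forall f, lc f -> (forall n, \sum_(i < n.+1) f (iter i g x0) <= 0) ->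
    lint mu f <= 0.
Proof.
pose l (n : nat) (f : X -> int) : R :=
  n.+1%:R^-1 * (\sum_(i < n.+1) f (iter i g x0))%:~R.
have n0 (n : nat) : (0 : R) < n.+1%:R^-1 by rewrite invr_gt0.
have pl n : pos_functional (l n).
  split.
  - by move=> f f' _ _; rewrite /l big_split intrD mulrDr.
  - by move=> k f _; rewrite /l -mulr_sumr intrM mulrCA.
  - move=> f _ f0; rewrite /l mulr_ge0 ?(ltW (n0 n))// ler0z.
    by apply: sumr_ge0.
  by rewrite /l sumr_const card_ord rmorph_nat mulVf// pnatr_eq0.
have [F [FU oF]] := ultraFilterLemma eventually_filter.
have [mu Hmu] := ultra_limit eX FU pl.
exists mu; split=> [|f lf Hf]; last first.
  apply: (cvgr_to_le (Hmu f lf)); near=> n.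
  by rewrite /l mulr_ge0_le0 ?(ltW (n0 n))// lerz0.
apply/(invariantP eX mu cg) => a la; apply/eqP; rewrite -subr_eq0; apply/eqP.
have la' := lc_ind la; have lag := lc_ind (lc_shift la).
apply: (norm_cvg_unique (cvgB (Hmu _ lag) (Hmu _ la'))).
(* Shifting the average telescopes: only the two ends of the orbit segment remain, a difference of
   at most [1 / (n + 1)]. *)
have E n : l n (ind (fun x => a (g x))) - l n (ind a) =
    n.+1%:R^-1 * (ind a (iter n.+1 g x0) - ind a x0)%:~R.
  rewrite /l -mulrBr -intrB -sumrB; congr (_ * _%:~R).
  rewrite -(big_mkord xpredT
    (fun i => ind (fun x => a (g x)) (iter i g x0) - ind a (iter i g x0))).
  by rewrite (telescope_sumr (fun i => ind a (iter i g x0)))//.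
apply/cvgrPdist_le => e e0.
have [N _ HN] := near_infty_natSinv_lt (PosNum e0).
apply: oF; exists N => // n /= Nn.
rewrite sub0r normrN [X in `|X|](E n) normrM gtr0_norm//.
have b1 : `|(ind a (iter n.+1 g x0) - ind a x0)%:~R : R| <= 1.
  by rewrite /ind; case: (a _); case: (a _); 
    rewrite ?subrr ?sub0r ?subr0 ?mulrNz ?normrN ?normr0 ?normr1 ?ler01.
apply: le_trans (ltW (HN n Nn)).
by rewrite -[leRHS]mulr1 ler_wpM2l// ltW.
Unshelve. all: by end_near. Qed.

Lemma invariant_compact : compact [set mu : Prob X R | invariant_measure g mu].
Proof.
rewrite compact_ultra => F FU FK.
have [rho Hrho] := ultra_limit eX FU (fun mu : Prob X R => lint_pf eX mu).
exists rho; split; last by apply: (Prob_cvg eX) => f lf; exact: Hrho.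
apply/(invariantP eX rho cg) => a la; apply/eqP; rewrite -subr_eq0; apply/eqP.
have la' := lc_ind la; have lag := lc_ind (lc_shift la).
apply: (norm_cvg_unique (cvgB (Hrho _ lag) (Hrho _ la'))).
apply: cvg_near_cst; apply: filterS FK => mu im.
by apply/eqP; rewrite subr_eq0; apply/eqP; exact: (invariant_lint im (lc_ind la)).
Qed.

Lemma invariant_convex :
  convex_measures [set mu : Prob X R | invariant_measure g mu].
Proof.
move=> mu nu t im inu /andP[t0 t1].
have t1' : 0 <= 1 - t by rewrite subr_ge0.
pose m1 : {measure set (borel X) -> \bar R} := mscale (NngNum t0) (Prob_measure mu).
pose m2 : {measure set (borel X) -> \bar R} := mscale (NngNum t1') (Prob_measure nu).
pose mm (n : nat) := if n is 0 then m1 else m2.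
pose m : set (borel X) -> \bar R := msum mm 2.
have mE A : m A = (t%:E * mu A + (1 - t)%:E * nu A)%E.
  by rewrite /m /msum 2!big_ord_recl/= big_ord0 adde0.
have m0 : m set0 = 0%E by exact: (measure0 (msum mm 2)).
have mge A : (0 <= m A)%E by exact: (measure_ge0 (msum mm 2)).
have ms : semi_sigma_additive m.
  exact: (@measure_semi_sigma_additive _ _ _ (msum mm 2)).
have mT : m setT = 1%E.
  rewrite mE (probability_setT (Prob_measure mu)) (probability_setT (Prob_measure nu)).
  by rewrite !mule1 -EFinD addrCA subrr addr0.
have [rho Hrho] := Prob_of_measure m0 mge ms mT.
exists rho; last by move=> A mA; rewrite Hrho// mE.
apply/(invariantP eX rho cg) => a la; apply: EFin_inj.
have lE c : lc c -> (lint rho (ind c))%:E =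
    (t%:E * (lint mu (ind c))%:E + (1 - t)%:E * (lint nu (ind c))%:E)%E.
  move=> lc'; rewrite !lint_ind// Hrho ?mE//.
  by apply: clopen_borel; exact/lc_clopen.
rewrite !lE//; last exact: lc_shift.
by rewrite (invariant_lint im (lc_ind la)) (invariant_lint inu (lc_ind la)).
Qed.

End InvariantMeasures.

(** * Return times, full support and absence of atoms *)

Section MinimalHomeo.
Context (R : realType) (X : ptopologicalType) (cl : nat -> X -> bool).
Hypothesis eX : clopen_enum cl.
Hypothesis infX : forall s : seq X, exists x, x \notin s.
Variable g : homeo X X.
Hypothesis ming : minimal_homeo g.
Implicit Types (mu nu rho : Prob X R) (a b u : X -> bool) (f : X -> int).

Let cX := ce_compact eX.

Lemma iter_inv_iter k n x : (k <= n)%N ->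
  iter k (homeo_inv g) (iter n g x) = iter (n - k) g x.
Proof.
elim: k => [|k IH] kn; first by rewrite subn0.
by rewrite iterS IH ?(ltnW kn)// -(subnSK kn) iterS homeo_funK.
Qed.

Lemma bounded_return u : lc u -> (exists x, u x) ->
  exists M : nat, forall x, exists2 i, (i < M)%N & u (iter i g x).
Proof.
move=> lu [x0 ux0].
have ou : open [set x | u x] by have /lc_clopen[] := lu.
have lk (k : int) : lc (fun x => u (homeo_iter g k x)).
  case: k => k /=; first by exact: (lc_iter g k lu).
  exact: (lc_iter (homeo_sym g) k.+1 lu).
have /compact_near_coveringP cov := cX.
have := @cov nat \oo (fun n x => exists2 k : int, (absz k <= n)%N & u (homeo_iter g k x)) _ _.
case.
  move=> x _; near_simpl.
  have [y [uy [k _ ky]]] := ming x (ex_intro _ x0 ux0) ou.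
  exists ([set y | u (homeo_iter g k y) = u (homeo_iter g k x)],
    [set n | (absz k <= n)%N]) => /=; first by split; [exact: lk|exists (absz k)].
  by case=> z n [/= zx kn]; exists k => //; rewrite zx ky.
(* Visits occur at times between [- N] and [N]; counting from [iter N g x] makes them
   nonnegative. *)
move=> N _ /(_ N (leqnn N)) HN; exists (N + N).+1 => x.
have [k kN uk] := HN (iter N g x) I.
case: k kN uk => k /= kN uk.
  by exists (k + N)%N; [lia|rewrite iterD].
exists (N - k.+1)%N; first by lia.
by move: uk; rewrite -iterS iter_inv_iter.
Qed.

(** A periodic point has a finite two-sided orbit [s]; a point outside [s] has a clopen
    neighbourhood missing [s], against density. *)
Lemma aperiodic x k : iter k.+1 g x != x.
Proof.
apply/eqP => per.
have orb n : iter n g x = iter (n %% k.+1) g x.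
  rewrite {1}(divn_eq n k.+1) addnC iterD; congr (iter _ g _).
  by elim: (n %/ k.+1)%N => [//|q IH]; rewrite mulSn addnC iterD per.
pose s := [seq iter i g x | i <- iota 0 k.+1].
have ins n : iter n g x \in s.
  by rewrite orb; apply/mapP; exists (n %% k.+1)%N; rewrite // mem_iota ltn_mod.
have orbs n : homeo_iter g n x \in s.
  case: n => n; first exact: ins.
  have -> : x = iter (n.+1 * k.+1) g x by rewrite orb modnMl.
  by rewrite [homeo_iter _ _ _]iter_inv_iter ?ins// leq_pmulr.
have [y ys] := infX s.
have [v [lv vy vs]] : exists v : X -> bool, [/\ lc v, v y & forall z, z \in s -> ~~ v z].
  elim: s ys {ins orbs} => [|z s IH]; first by exists (fun=> true); split=> //; exact: lc_cst.
  rewrite inE negb_or => /andP[yz /IH[v [lv vy vs]]].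
  have [n nyz] : exists n, cl n y != cl n z.
    apply: contrapT => /forallNP no; move/eqP: yz; apply; apply: (ce_sep eX) => n.
    by apply/eqP/negPn/negP; exact: no.
  exists (fun w => v w && (cl n w == cl n y)); split.
  - apply: lc_andb => //; apply: (lc_comp (fun t : bool => t == cl n y)); exact: (ce_lc eX).
  - by rewrite vy eqxx.
  - by move=> w; rewrite inE negb_and => /orP[/eqP ->|/vs ->//]; rewrite eq_sym nyz orbT.
have ov : open [set x | v x] by have /lc_clopen[] := lv.
have [w [vw [n _ nw]]] := ming x (ex_intro _ y vy) ov.
have ws : w \in s by rewrite -nw orbs.
by move: (vs w ws); rewrite (vw : v w).
Qed.

(** By aperiodicity some clopen [v] around [x] misses the next [M - 1] points of the orbit. The part
    of [v] that does not return to [v] in that time has [M] disjoint preimages, all of the same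
    measure. *)
Lemma small_neighbourhood x (M : nat) : exists u : X -> bool, [/\ lc u, u x &
  forall mu, invariant_measure g mu -> M%:R * lint mu (ind u) <= 1].
Proof.
have [v [lv vx vs]] : exists v : X -> bool, [/\ lc v, v x &
    forall k, (0 < k < M)%N -> ~~ v (iter k g x)].
  elim: M => [|M [v [lv vx vs]]].
    by exists (fun=> true); split=> [||k]//; [exact: lc_cst|rewrite ltn0 andbF].
  case: M vs => [|M] vs.
    by exists v; split=> // k; lia.
  have [n nyz] : exists n, cl n x != cl n (iter M.+1 g x).
    apply: contrapT => /forallNP no; move/eqP: (aperiodic x M); apply.
    apply: (ce_sep eX) => n.
    by apply/eqP/negPn/negP; rewrite eq_sym; exact: no.
  exists (fun w => v w && (cl n w == cl n x)); split.
  - apply: lc_andb => //; apply: (lc_comp (fun t : bool => t == cl n x)); exact: (ce_lc eX).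
  - by rewrite vx eqxx.
  - move=> k /andP[k0]; rewrite ltnS leq_eqVlt negb_and => /orP[/eqP ->|kM].
      by rewrite eq_sym nyz orbT.
    by rewrite vs// k0.
pose u y := v y && all (fun k => ~~ v (iter k g y)) (iota 1 M.-1).
have lu : lc u.
  apply: lc_andb => //; elim: (iota _ _) => [|k s IH]; first exact: lc_cst.
  by apply: lc_andb => //; apply: lc_negb; exact: lc_iter.
exists u; split=> //.
  rewrite /u vx; apply/allP => k; rewrite mem_iota => kM.
  by apply: vs; lia.
move=> mu im; have pm := lint_pf eX mu.
have lui i : lc (ind (fun y => u (iter i g y))) by apply: lc_ind; exact: lc_iter.
have [lS SE] := pf_sum M (fun=> 1) pm lui.
have : lint mu (fun y => \sum_(i < M) 1 * ind (fun y => u (iter i g y)) y) <= 1.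
  rewrite -[leRHS](pf1 pm); apply: (pf_le pm) => //; first exact: lc_cst.
  move=> y; under eq_bigr do rewrite mul1r /ind.
  rewrite (sum_ind_has (P := fun i => u (iter i g y))); first by case: has.
  move=> i j iM jM; wlog ij : i j iM jM / (i < j)%N.
    by move=> W; case: (ltngtP i j) => // ij ui uj; [|apply/esym]; exact: W.
  move=> /andP[_ /allP al] /andP[vj _]; have := al (j - i)%N.
  rewrite /= mem_iota -iterD (subnK (ltnW ij)) => H.
  have : ~~ v (iter j g y) by apply: H; lia.
  by rewrite vj.
rewrite SE (eq_bigr (fun=> lint mu (ind u))); last first.
  by move=> i _; rewrite mul1r; exact: (invariant_iter eX i im (lc_ind lu)).
by rewrite sumr_const card_ord mulr_natl.
Qed.

(** By bounded returns, finitely many preimages of a clopen subset of [U] cover [X], and all have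
    the same measure. *)
Lemma invariant_full_support mu : invariant_measure g mu -> full_support mu.
Proof.
move=> im U oU [x Ux].
have [n [nx nU]] := ce_nbhs eX (open_nbhs_nbhs (conj oU Ux)).
have ln := ce_lc eX n; have pm := lint_pf eX mu.
have [M HM] := bounded_return ln (ex_intro _ x nx).
have lui i : lc (ind (fun y => cl n (iter i g y))) by apply: lc_ind; exact: lc_iter.
have [lS SE] := pf_sum M (fun=> 1) pm lui.
have : 1 <= lint mu (fun y => \sum_(i < M) 1 * ind (fun y => cl n (iter i g y)) y).
  rewrite -[leLHS](pf1 pm); apply: (pf_le pm) => //; first exact: lc_cst.
  move=> y; have [i iM ui] := HM y.
  rewrite (bigD1 (Ordinal iM))//= /ind ui mulr1 lerDl.
  by apply: sumr_ge0 => j _; rewrite mul1r.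
rewrite SE (eq_bigr (fun=> lint mu (ind (cl n)))); last first.
  by move=> i _; rewrite mul1r; exact: (invariant_iter eX i im (lc_ind ln)).
rewrite sumr_const card_ord => M1.
have pos : 0 < lint mu (ind (cl n)).
  rewrite lt_neqAle (pf_ind_ge0 pm)// andbT; apply/eqP => e0.
  by move: M1; rewrite -e0 mul0rn ler10.
have : (0 < mu [set y | cl n y])%E by rewrite -lint_ind// lte_fin.
move=> /lt_le_trans; apply; apply: le_measure; rewrite ?inE.
- by apply: clopen_borel; exact/lc_clopen.
- exact: sub_sigma_algebra.
- exact: nU.
Qed.

(** Each point has a clopen neighbourhood of measure below that of a supposed atom [A], hence
    meeting [A] in a null set; countably many of these cover [A]. *)
Lemma invariant_atomless mu : invariant_measure g mu -> atomless mu.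
Proof.
move=> im A [mA A0 atom].
have fA : mu A \is a fin_num by exact: (fin_num_measure (Prob_measure mu)).
have r0 : 0 < fine (mu A) by rewrite fine_gt0// A0 ltey_eq fA.
pose M := (Num.trunc (fine (mu A))^-1).+1.
have M1 : 1 < M%:R * fine (mu A).
  by rewrite -ltr_pdivrMr// div1r; exact: truncnS_gt.
pose good n := (lint mu (ind (cl n)) < fine (mu A)).
have mcl n : measurable ([set y | cl n y] : set (borel X)).
  by apply: clopen_borel; apply/lc_clopen; exact: (ce_lc eX).
have null n : good n -> mu (A `&` [set y | cl n y]) = 0%E.
  move=> gn; apply: atom; first exact: measurableI.
    by move=> y [].
  apply: (@le_lt_trans _ _ (mu [set y | cl n y])).
    by apply: le_measure; rewrite ?inE//; exact: measurableI.
  rewrite -lint_ind; last exact: (ce_lc eX).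
  by rewrite -(fineK fA) lte_fin.
suff : mu A = 0%E by move=> e; rewrite e ltxx in A0.
have -> : A = \bigcup_(n in [set n | good n]) (A `&` [set y | cl n y]).
  apply/seteqP; split=> [y Ay|y [n _ []]//].
  have [u [lu uy Hu]] := small_neighbourhood y M.
  have [n nE] := ce_surj eX lu.
  exists n; last by split=> //=; rewrite nE.
  rewrite /= /good nE.
  have := Hu mu im; have M0 : (0 : R) < M%:R by rewrite ltr0n.
  by rewrite -(ltr_pM2l M0); lra.
have : (Prob_measure mu).-negligible
    (\bigcup_(n in [set n | good n]) (A `&` [set y | cl n y])).
  rewrite bigcup_mkcond; apply: negligible_bigcup => n.
  case: ifPn => [/set_mem gn|_]; last exact: negligible_set0.
  exists (A `&` [set y | cl n y]); split=> //; first exact: measurableI.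
  exact: null.
move=> /(measure_negligible _); apply.
apply: bigcup_measurable => n _; exact: measurableI.
Qed.

End MinimalHomeo.

(** * Goodness and approximate divisibility of the invariant measures *)

Section GoodDivisible.
Context (R : realType) (X : ptopologicalType) (cl : nat -> X -> bool).
Hypothesis eX : clopen_enum cl.
Hypothesis infX : forall s : seq X, exists x, x \notin s.
Variable g : homeo X X.
Hypothesis ming : minimal_homeo g.
Implicit Types (mu nu rho : Prob X R) (a b u : X -> bool) (f : X -> int).

Let cX := ce_compact eX.

Lemma lc_first (Q : X -> nat -> bool) (exQ : forall x, exists n, Q x n) :
  (forall n, lc (Q^~ n)) -> lc (fun x => ex_minn (exQ x)).
Proof.
move=> lQ x; case: (ex_minnP (exQ x)) => k Qk kmin.
have lpre : lc (fun y => [seq Q y i | i <- iota 0 k.+1]).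
  elim: (iota 0 k.+1) => [|i s IH]; first exact: lc_cst.
  exact: (lc_comp2 cons).
apply: filterS (lpre x) => y E.
have QE i : (i <= k)%N -> Q y i = Q x i.
  move=> ik; have := congr1 (nth false ^~ i) E.
  by rewrite !(nth_map 0%N) ?size_iota// nth_iota.
case: ex_minnP => m Qm mmin; apply/eqP; rewrite eqn_leq mmin ?QE//=.
rewrite leqNgt; apply/negP => mk; have := kmin m.
by rewrite -QE ?(ltnW mk)// leqNgt mk => /(_ Qm).
Qed.

Let S f x n : int := \sum_(i < n) f (iter i g x).

Let SD f x m n : S f x (m + n) = S f x m + S f (iter m g x) n.
Proof.
rewrite /S big_split_ord /=; congr (_ + _).
by apply: eq_bigr => i _; rewrite addnC iterD.
Qed.

Let S1 f x : S f x 1 = f x.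
Proof. by rewrite /S big_ord1. Qed.

Let lcS f n : lc f -> lc (fun x => S f x n).
Proof.
move=> lf; rewrite /S; elim: n => [|n IH].
  by under eq_fun do rewrite big_ord0; exact: lc_cst.
under eq_fun do rewrite big_ord_recr /=.
by apply: lc_intD => //; exact: lc_iter.
Qed.

(* Read the points of [a \ b] as opening and those of [b \ a] as closing
   parentheses along the orbits, and match them. *)
Lemma invariant_good a b : lc a -> lc b ->
  (forall mu, invariant_measure g mu -> lint mu (ind a) < lint mu (ind b)) ->
  exists c : X -> bool, [/\ lc c, forall x, c x -> b x &
    forall mu, invariant_measure g mu -> lint mu (ind c) = lint mu (ind a)].
Proof.
move=> la lb ab.
pose f x := ind b x - ind a x.
have lf : lc f by apply: lc_intB; exact: lc_ind.
have f1 x : f x <= 1 by rewrite /f /ind; case: (a x); case: (b x).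
(* Otherwise all partial sums along the orbit of [x] are negative, and an orbit measure gives [b] at
   most the measure of [a]. *)
have exQ x : exists n, 0 <= S f x n.+1.
  apply: contrapT => /forallNP no.
  have [mu [im Hmu]] := orbit_measure R eX g x.
  have := Hmu f lf; rewrite (pfB (lint_pf eX mu)); try exact: lc_ind.
  rewrite subr_le0 leNgt (ab mu im) => H; apply: notF; apply: H => n.
  by have /negP := no n; rewrite -ltNge => /ltW.
pose k x := ex_minn (exQ x).
have lk : lc k.
  by apply: lc_first => n; apply: (lc_comp (fun z : int => 0 <= z)); exact: lcS.
pose o x := a x && ~~ b x.
have lo : lc o by exact: lc_diff.
(* [k x] is the first time at which the sum, starting with [-1], ceases to be negative. As no term
   exceeds 1, the sum is then exactly 0 and its last term is 1: [x] is matched with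
   [iter (k x) g x]. *)
have kP x : o x -> [/\ S f x (k x).+1 = 0, f (iter (k x) g x) = 1 &
    forall j, (0 < j <= k x)%N -> S f x j < 0].
  move=> /andP[ax nbx]; rewrite /k; case: ex_minnP => n Sn nmin.
  have neg j : (0 < j <= n)%N -> S f x j < 0.
    case: j => // j; rewrite /= => jn; rewrite ltNge; apply/negP => /nmin.
    by rewrite leqNgt jn.
  have fx : f x = -1 by rewrite /f /ind ax (negbTE nbx).
  have n0 : (0 < n)%N.
    by case: n Sn {nmin neg} => // ; rewrite S1 fx.
  have := neg n; rewrite n0 leqnn => /(_ isT) Sn1.
  have := SD f x n 1; rewrite addn1 S1 => E.
  by have := f1 (iter n g x); split=> //; lia.
have [N HN] : exists N, forall x, (k x < N)%N.
  have [ws Hws] := fin_range cX lk; exists (\max_(w <- ws) w).+1 => x.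
  by rewrite ltnS (big_rem _ (Hws x)) /= leq_maxl.
pose E j x := o x && (k x == j).
have lE j : lc (E j) by apply: lc_andb => //; exact: (lc_comp (fun n => n == j)).
pose Q x j := E j (iter j (homeo_inv g) x).
have lQ j : lc (Q^~ j) by exact: (lc_iter (homeo_sym g)).
have itK j x : iter j g (iter j (homeo_inv g) x) = x.
  have := @iter_inv_iter X (homeo_sym g) j j x (leqnn j).
  by rewrite subnn.
(* If [x] closed both [z] and a later [y], the sum from [z] would vanish just before [y], earlier
   than its first return to 0. *)
have Quniq x i j : (i < N)%N -> (j < N)%N -> Q x i -> Q x j -> i = j.
  wlog ij : i j / (i < j)%N.
    by move=> W; case: (ltngtP i j) => // ij iN jN qi qj; [|apply/esym]; exact: W.
  move=> _ _ /andP[oi /eqP ki] /andP[oj /eqP kj].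
  set y := iter i _ x in oi ki; set z := iter j _ x in oj kj.
  have yz : y = iter (j - i) g z.
    have -> : z = iter (j - i) (homeo_inv g) y.
      by rewrite /z /y -iterD subnK// ltnW.
    by rewrite itK.
  have [Sy _ _] := kP _ oi; have [Sz _ neg] := kP _ oj.
  rewrite ki in Sy; rewrite kj in Sz neg.
  have := SD f z (j - i) i.+1; rewrite -yz Sy.
  have -> : (j - i + i.+1)%N = j.+1 by lia.
  rewrite Sz addr0; have : S f z (j - i) < 0 by apply: neg; lia.
  by move=> + E0; rewrite -E0.
(* Common points are kept, and each opening point is replaced by its match; [Q x j] says that [x]
   closes the point [j] steps before it. *)
pose c x := (a x && b x) || has (Q x) (iota 0 N).
have lh : lc (fun x => has (Q x) (iota 0 N)).
  elim: (iota 0 N) => [|j s IH]; first exact: lc_cst.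
  exact: lc_orb.
have Qb x j : Q x j -> b x && ~~ a x.
  move=> /andP[oj /eqP kj]; have [_ fj _] := kP _ oj.
  by move: fj; rewrite kj itK /f /ind; case: (a x); case: (b x).
have lab : lc (fun x => a x && b x) by exact: lc_andb.
exists c; split; first exact: lc_orb.
  by move=> x /orP[/andP[]//|/hasP[j _ /Qb/andP[]]].
move=> mu im; have pm := lint_pf eX mu.
rewrite (pf_disjU pm)//; last first.
  move=> x /andP[ax bx]; apply/negP => /hasP[j _ /Qb].
  by rewrite ax andbF.
have [lS1 SE1] := pf_sum N (fun=> 1) pm (fun j => lc_ind (lQ j)).
have [lS2 SE2] := pf_sum N (fun=> 1) pm (fun j => lc_ind (lE j)).
have -> : ind (fun x => has (Q x) (iota 0 N)) =
    (fun x => \sum_(j < N) 1 * ind (Q^~ j) x).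
  apply/funext => x; under eq_bigr do rewrite mul1r.
  by rewrite /ind (sum_ind_has (P := Q x))// => i j; exact: Quniq.
rewrite SE1 (eq_bigr (fun j : 'I_N => 1%:~R * lint mu (ind (E j)))); last first.
  move=> j _; rewrite -(invariant_iter eX j im (lc_ind (lQ j))).
  congr (_ * lint mu _); apply/funext => x.
  by rewrite /ind /Q iter_inv_iter// subnn.
rewrite -SE2 -(pfD pm)//; last exact: lc_ind.
congr (lint mu _); apply/funext => x; under eq_bigr do rewrite mul1r.
rewrite /ind (sum_ind_has (P := E^~ x)); last first.
  by move=> i j _ _ /andP[_ /eqP <-] /andP[_ /eqP].
have -> : has (E^~ x) (iota 0 N) = o x.
  apply/hasP/idP => [[j _ /andP[]//]|ox]; exists (k x).
    by rewrite mem_iota HN.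
  by rewrite /E ox eqxx.
by rewrite /o; case: (a x); case: (b x).
Qed.

(* Colour each point by the number, modulo [n], of its visits to [a] until it
   enters the small set [u]; the colour classes cut [a] into [n] pieces of
   almost equal measure. *)
Lemma invariant_divisible a (n : nat) (e : R) : lc a -> (0 < n)%N -> 0 < e ->
  exists c : X -> bool, [/\ lc c, forall x, c x -> a x &
    forall mu, invariant_measure g mu ->
      lint mu (ind a) - e <= n%:R * lint mu (ind c) <= lint mu (ind a)].
Proof.
move=> la n0 e0.
(* Chosen so that [n] times the measure of [u], at most [n / M], stays below [e]. *)
pose M := (Num.trunc (n%:R / e)).+1.
have M0 : (0 : R) < M%:R by rewrite ltr0n.
have Mn : n%:R / e < M%:R by exact: truncnS_gt.
have [u [lu ux0 Hu]] := @small_neighbourhood R X cl eX infX g ming point M.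
have [T HT] := bounded_return eX ming lu (ex_intro _ point ux0).
have exQ x : exists t, u (iter t g x) by have [t _ ut] := HT x; exists t.
pose t x := ex_minn (exQ x).
have lt : lc t by apply: lc_first => i; exact: lc_iter.
pose s x : int := S (ind a) x (t x).+1.
have ls : lc s.
  by apply: (lc_diag (F := fun i x => S (ind a) x i.+1)) => // i; apply: lcS; exact: lc_ind.
have su x : u x -> s x = ind a x.
  move=> ux; rewrite /s; have -> : t x = 0.
    by rewrite /t; case: ex_minnP => m _ /(_ 0); rewrite /= ux leqn0 => /(_ isT)/eqP.
  exact: S1.
have sn x : ~~ u x -> s x = ind a x + s (g x).
  move=> nux; rewrite /s.
  have -> : t x = (t (g x)).+1.
    rewrite /t; case: ex_minnP => m um mmin; case: ex_minnP => m' um' mmin'.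
    case: m um mmin => [|m] um mmin; first by rewrite /= (negbTE nux) in um.
    congr _.+1; apply/eqP; rewrite eqn_leq; apply/andP; split.
      by rewrite -ltnS; apply: mmin; rewrite iterSr.
    by apply: mmin'; rewrite -iterSr.
  by rewrite -add1n SD S1.
pose P (j : nat) x := (s x == j%:Z %[mod n%:Z])%Z.
have lP j : lc (P j) by exact: (lc_comp (fun k : int => (k == j%:Z %[mod n%:Z])%Z)).
have nz : n%:Z != 0 by rewrite eqz_nat -lt0n.
have PS j x : ~~ u x -> a x -> P j.+1 x = P j (g x).
  move=> nux ax; rewrite /P sn// /ind ax.
  have -> : j.+1%:Z = 1 + j%:Z by lia.
  by rewrite eqz_modDl.
pose al j := fun x => a x && P j x.
have lal j : lc (al j) by exact: lc_andb.
have lg j : lc (fun x => P j (g x)) by exact: (lc_shift g (lP j)).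
(* By invariance [P j] and its shift have the same integral. Off [u] the pointwise relation is an
   equality; on [u] the count [s] is 0 or 1, so a gain there requires [n] to divide [j]. *)
have stepm mu j : invariant_measure g mu ->
    lint mu (ind (al j.+1)) <= lint mu (ind (al j)) +
      (n %| j)%N%:Z%:~R * lint mu (ind u).
  move=> im; have pm := lint_pf eX mu.
  have lPj := lc_ind (lP j); have lgj := lc_ind (lg j).
  have key : lint mu (fun x => ind (al j.+1) x + ind (P j) x) <=
      lint mu (fun x => (ind (al j) x + ind (fun x => P j (g x)) x) +
         (n %| j)%N%:Z * ind u x).
    apply: (pf_le pm).
    - by apply: lc_intD => //; exact: lc_ind.
    - apply: lc_intD; last by apply: lc_intZ; exact: lc_ind.
      by apply: lc_intD => //; exact: lc_ind.
    move=> x; rewrite /ind /al; have [ux|nux] := boolP (u x); last first.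
      have [ax|nax] := boolP (a x); first by rewrite (PS j x nux ax) /=; lia.
      have -> : P j (g x) = P j x by rewrite /P (sn x nux) /ind (negbTE nax) add0r.
      by rewrite /=; lia.
    have [ax|nax] := boolP (a x); last first.
      have -> : P j x = (n %| j)%N.
        by rewrite /P (su x ux) /ind (negbTE nax) eq_sym eqz_mod_dvd subr0.
      by rewrite /=; case: (n %| j)%N; case: (P j (g x)).
    have -> : P j.+1 x = (n %| j)%N.
      rewrite /P (su x ux) /ind ax eq_sym eqz_mod_dvd.
      by have -> : j.+1%:Z - 1 = j%:Z by lia.
    by rewrite /=; case: (n %| j)%N; case: (P j (g x)); case: (P j x).
  move: key; rewrite !(pfD pm) ?(pfZ pm)//; try exact: lc_ind; last 2 first.
  - by apply: lc_intD => //; exact: lc_ind.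
  - by apply: lc_intZ; exact: lc_ind.
  have := invariant_lint eX im lPj; rewrite /= => E.
  have -> : lint mu (ind (fun x => P j (g x))) = lint mu (ind (P j)) by exact: E.
  lra.
(* From [al 1] to [al n = al 0] the measures do not increase, and from [al 0] to [al 1] they gain at
   most that of [u]. So [al 0] is the smallest class, and all classes are within the measure of [u]
   of it. *)
exists (al 0); split=> // [x /andP[]//|mu im].
have pm := lint_pf eX mu.
have U0 : 0 <= lint mu (ind u) by exact: (pf_ind_ge0 pm).
have alE : al n = al 0.
  by apply/funext => x; rewrite /al /P modzz mod0z.
have down d j : (0 < j)%N -> (j + d <= n)%N ->
    lint mu (ind (al (j + d)%N)) <= lint mu (ind (al j)).
  move=> j0; elim: d => [|d IH] jd; first by rewrite addn0.
  rewrite addnS; apply: le_trans (IH _); last by lia.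
  have := stepm mu (j + d)%N im.
  have -> : (n %| j + d)%N = false by apply/negbTE; rewrite gtnNdvd//; lia.
  by rewrite mul0r addr0.
have lo j : (j < n)%N -> lint mu (ind (al 0)) <= lint mu (ind (al j)).
  case: j => // j jn; have := down (n - j.+1)%N j.+1 isT.
  by rewrite subnKC ?(ltnW jn)// leqnn alE; apply.
have hi j : (j < n)%N -> lint mu (ind (al j)) <= lint mu (ind (al 0)) + lint mu (ind u).
  case: j => [|j] jn; first by rewrite lerDl.
  have := down j 1%N isT; rewrite add1n => /(_ (ltnW jn)) h.
  have := stepm mu 0 im; rewrite dvdn0 mul1r; exact: le_trans.
have [lS SE] := pf_sum n (fun=> 1) pm (fun j => lc_ind (lal j)).
have SA : \sum_(j < n) lint mu (ind (al j)) = lint mu (ind a).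
  transitivity (\sum_(j < n) 1%:~R * lint mu (ind (al j))).
    by apply: eq_bigr => j _; rewrite mul1r.
  rewrite -SE; congr (lint mu _); apply/funext => x.
  under eq_bigr do rewrite mul1r.
  rewrite /ind (sum_ind_has (P := fun j => al j x)); last first.
    move=> i j iN jN /andP[_ /eqP Pi] /andP[_ /eqP]; rewrite Pi !modz_small; lia.
  congr (_ : bool)%:Z; apply/hasP/idP => [[j _ /andP[]//]|ax].
  have s0 : (0 <= (s x %% n)%Z) by exact: modz_ge0.
  have sl : ((s x %% n)%Z < n%:Z) by apply: ltz_pmod; lia.
  exists (absz (s x %% n)%Z); first by rewrite mem_iota; lia.
  by rewrite /al ax /P gez0_abs// modz_mod eqxx.
have nU : n%:R * lint mu (ind u) <= e.
  have := Hu mu im; rewrite -(ler_pdivlMl _ _ M0) mulr1 => h.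
  apply: (@le_trans _ _ (n%:R / M%:R)); first by rewrite ler_wpM2l.
  by rewrite ler_pdivrMr// -ler_pdivrMl// mulrC ltW.
apply/andP; split.
  have : lint mu (ind a) <= \sum_(j < n) (lint mu (ind (al 0)) + lint mu (ind u)).
    by rewrite -SA; apply: ler_sum => j _; exact: hi.
  by rewrite sumr_const card_ord -[X in _ <= X]mulr_natl mulrDr; lra.
rewrite -SA mulr_natl -[n in X in X <= _]card_ord -sumr_const.
by apply: ler_sum => j _; exact: lo.
Qed.

End GoodDivisible.

(** * The two directions together *)

Lemma minimal_dynamical_simplex (R : realType) (X : ptopologicalType)
    (cl : nat -> X -> bool) (g : homeo X X) :
  clopen_enum cl -> (forall s : seq X, exists x, x \notin s) ->
  minimal_homeo g ->
  dynamical_simplex [set mu : Prob X R | invariant_measure g mu].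
Proof.
move=> eX infX ming; split.
- by have [mu [im _]] := orbit_measure R eX g point; exists mu.
- exact: (invariant_compact eX).
- exact: (invariant_convex eX).
- exact: (invariant_atomless eX infX ming).
- exact: (invariant_full_support eX ming).
- move=> A B cA cB AB.
  have [|c [lc' cb ca]] := invariant_good eX (clopen_lc cA) (clopen_lc cB) (g := g) (R := R).
    by move=> mu im; rewrite -lte_fin !lint_set//; exact: AB.
  exists [set x | c x]; split; first exact/lc_clopen.
    by move=> x /cb /set_mem.
  by move=> mu im; rewrite -lint_ind// ca// lint_set.
move=> A n e cA n1 e0.
have [c [lc' ca H]] := invariant_divisible eX infX ming (clopen_lc cA) n1 e0.
exists [set x | c x]; split; first exact/lc_clopen.
  by move=> x /ca /set_mem.
move=> mu im; have := H mu im; have <- := lint_set mu cA.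
by have <- := lint_ind mu lc'; rewrite -EFinB -EFinM !lee_fin.
Qed.

Theorem theorem1p1 (R : realType) (X : ptopologicalType)
    (hX : is_cantor_space X) (K : set (Prob X R)) :
  (exists g : homeo X X,
     minimal_homeo g /\ K = [set mu : Prob X R | invariant_measure g mu])
  <-> dynamical_simplex K.
Proof.
have [h] := hX; have [cl eX] := cantor_clopen_enum h.
split=> [[g [ming ->]]|dK]; last exact: (simplex_realization eX dK).
exact: (minimal_dynamical_simplex R eX (cantor_infinite h) ming).
Qed.
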